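(* For every (contractive) finite rank Hilbert $A$-module $H$, with associated completely positive map $\phi(B)=T_1BT_1^*+\dots+T_dBT_d^*$ on $\mathcal B(H)$, $$\chi(H)=d!\,\lim_{n\to\infty}\frac{\mathrm{rank}\,(\mathbf 1-\phi^{n+1}(\mathbf 1))}{n^d}.$$
   Context: Let $d\ge1$, $A=\mathbb C[z_1,\dots,z_d]$. A (contractive) Hilbert $A$-module is a complex Hilbert space $H$ with commuting bounded operators $T_1,\dots,T_d$ (its canonical operators) satisfying $\|T_1\xi_1+\dots+T_d\xi_d\|^2\le\|\xi_1\|^2+\dots+\|\xi_d\|^2$ for all $\xi_k\in H$, made into an $A$-module by $f\cdot\xi=f(T_1,\dots,T_d)\xi$. Put $\Delta=(\mathbf 1-T_1T_1^*-\dots-T_dT_d^* )^{1/2}$; $\mathrm{rank}(H)$ is the dimension of the closure of $\Delta H$. If $\mathrm{rank}(H)<\infty$ then every $\mathbf 1-\phi^{n}(\mathbf 1)$ is a positive finite rank operator. Euler characteristic (for $\mathrm{rank}(H)<\infty$): $M_H=\mathrm{span}\{f\cdot\Delta\xi:f\in A,\ \xi\in H\}$ (no closure taken) is a finitely generated $A$-module, so it has a finite free resolution $0\to F_n\to\dots\to F_1\to M_H\to0$ with $F_k$ a free $A$-module of finite rank $\beta_k$; $\chi(H)=\sum_{k=1}^n(-1)^{k+1}\beta_k$, which is independent of the resolution. *)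

(* Defs.v *)
(* MathComp / MathComp-Analysis *)
From HB Require Import structures.
From mathcomp Require Import all_boot all_order all_algebra.
From mathcomp Require Import sesquilinear complex.
(* mpoly's notations are incompatible with those of MathComp-Analysis: the
   polynomial ring C[z_1, ..., z_d] is written [mpoly d C] below. *)
From mathcomp Require Import -(notations) mpoly.
From mathcomp Require Import all_classical all_reals all_analysis.

Set Implicit Arguments.
Unset Strict Implicit.
Unset Printing Implicit Defensive.

Import Order.TTheory GRing.Theory Num.Theory.
Import numFieldNormedType.Exports.

Local Open Scope classical_set_scope.
Local Open Scope ring_scope.

Section Dimension.
Variables (K : fieldType) (V : lmodType K).

Definition lin_indep (n : nat) (b : 'I_n -> V) : Prop :=
  forall a : 'I_n -> K, \sum_(i < n) a i *: b i = 0 -> forall i, a i = 0.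

Definition has_dim (S : set V) (n : nat) : Prop :=
  exists b : 'I_n -> V,
    lin_indep b /\ S = range (fun a : 'I_n -> K => \sum_(i < n) a i *: b i).

Definition finite_dim (S : set V) : Prop := exists n, has_dim S n.

(* Only meaningful when [finite_dim S]; the value is 0 otherwise. *)
Definition set_dim (S : set V) : nat := xget 0%N [set n | has_dim S n].

End Dimension.

(* The scalars are R[i]; [hdot] is linear in its first argument. *)
Record hilbertSpace (R : realType) := HilbertSpace {
  hcarrier :> completeNormedModType R[i];
  hdot : {dot hcarrier for (@Num.conj R[i])};
  hdot_norm : forall x : hcarrier, `|x| ^+ 2 = hdot x x
}.

Section Operators.
Variables (R : realType) (H : hilbertSpace R).

(* For a bounded operator f, Riesz representation provides exactly one such g. *)
Definition adjoint (f : H -> H) : H -> H :=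
  xget (fun=> 0) [set g | forall x y, hdot H (f x) y = hdot H x (g y)].

(* For a bounded positive operator f, there is exactly one such g. *)
Definition sqrt_op (f : H -> H) : H -> H :=
  xget (fun=> 0) [set g | [/\ linear g, continuous g,
    forall x, 0 <= hdot H (g x) x & g \o g = f]].

End Operators.

Record hilbertModule (R : realType) (d : nat) := HilbertModule {
  hspace :> hilbertSpace R;
  hop : 'I_d -> {linear hspace -> hspace};
  hop_continuous : forall i, continuous (hop i);
  hop_comm : forall i j x, hop i (hop j x) = hop j (hop i x);
  hop_contractive : forall xi : 'I_d -> hspace,
    `|\sum_(i < d) hop i (xi i)| ^+ 2 <= \sum_(i < d) `|xi i| ^+ 2
}.

Section HilbertModule.
Variables (R : realType) (d : nat) (H : hilbertModule R d).
Local Notation A := (mpoly d R[i]).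
Local Notation T := (hop H).

Definition monomial_act (m : multinom d) (x : H) : H :=
  foldr (fun i => iter (m i) (T i)) x (enum 'I_d).

Definition act (f : A) (x : H) : H :=
  \sum_(m <- msupp f) mcoeff m f *: monomial_act m x.

Definition phi (B : H -> H) : H -> H :=
  fun x => \sum_(i < d) T i (B (adjoint (T i) x)).

Definition defect : H -> H :=
  sqrt_op (fun x : H => x - \sum_(i < d) T i (adjoint (T i) x)).

Definition finite_rank : Prop := finite_dim (closure (range defect)).

Definition defect_submodule : set H :=
  [set x | exists s : seq (A * H), x = \sum_(p <- s) act p.1 (defect p.2)].

(* A finite resolution 0 -> F_n -> ... -> F_1 -> M_H -> 0 with F_(k+1) equal to
   A ^ (fr_rank k): it is extended by F_(k+1) = 0 for k >= n = fr_len, so that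
   exactness at F_n says that F_n -> F_(n-1) is injective. *)
Record free_resolution := FreeResolution {
  fr_len : nat;
  fr_rank : nat -> nat;
  fr_rank0 : forall k, (fr_len <= k)%N -> fr_rank k = 0%N;
  fr_map : forall k, {linear 'rV[A]_(fr_rank k.+1) -> 'rV[A]_(fr_rank k)};
  fr_aug : 'rV[A]_(fr_rank 0) -> H;
  fr_augD : forall u v, fr_aug (u + v) = fr_aug u + fr_aug v;
  fr_augZ : forall (f : A) v, fr_aug (f *: v) = act f (fr_aug v);
  fr_aug_range : range fr_aug = defect_submodule;
  fr_exact0 : forall v, fr_aug v = 0 <-> exists w, fr_map 0 w = v;
  fr_exact : forall k v, fr_map k v = 0 <-> exists w, fr_map k.+1 w = v
}.

Definition resolution_char (F : free_resolution) : int :=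
  \sum_(k < fr_len F) (-1) ^+ k * (fr_rank F k)%:Z.

(* If H has finite rank, M_H has a finite free resolution and all of them have
   the same characteristic. *)
Definition euler_char : int :=
  xget 0 [set c | exists F : free_resolution, c = resolution_char F].

End HilbertModule.

(* Main.v *)
Require Import Defs.
From HB Require Import structures.
From mathcomp Require Import all_boot all_order all_algebra.
From mathcomp Require Import sesquilinear complex.
From mathcomp Require Import -(notations) mpoly.
From mathcomp Require Import all_classical all_reals all_analysis.
From mathcomp Require ssrcomplements.
From mathcomp Require Import ring lra.
Import Order.TTheory GRing.Theory Num.Theory.
Import numFieldNormedType.Exports.

Local Open Scope classical_set_scope.
Local Open Scope ring_scope.

Set Implicit Arguments.
Unset Strict Implicit.
Unset Printing Implicit Defensive.

(* Write A = C[z_1, ..., z_d], let g_1, ..., g_r span Delta H, and let M_n be the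
   space of all sums of f_i g_i with deg f_i <= n, so that M_H is the union of the M_n.

   Since 1 - phi^(n+1)(1) = Delta^2 + sum_i T_i (1 - phi^n(1)) T_i^*, its range lies
   in M_n, and a vector v with <(1 - phi^(n+1)(1)) v, v> = 0 is orthogonal to M_n;
   hence it is injective on the finite dimensional space M_n and has range M_n.

   Choose a maximal A-independent subfamily of the g_j, of size m.  Each of the other
   r - m generators has a nonzero multiple in the span of the subfamily, so with
   N_n = dim A_(<= n) = binomial (n + d) d and some constant c,
   m N_n <= dim M_n <= r N_n - (r - m) N_(n - c), whence d! dim M_n / n^d -> m.

   For any finite free resolution, exactness survives over the fraction field of A,
   so the alternating sum of the ranks telescopes to m.  Free resolutions exist by
   induction on the number of variables: for M finitely generated over S = R[x], with
   M_n the R-submodule generated in x-degree < n, the sequence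
   0 -> S (x) M_n -> S (x) M_(n+1) -> M -> 0 is exact for large n when R is
   Noetherian, and the mapping cone of resolutions of its first two terms
   resolves M. *)

(** * Hilbert's syzygy theorem *)

(** The familiar sequence 0 -> R[x] (x) M -> R[x] (x) M -> M -> 0 does not serve the induction on
    the variables, since M is seldom finitely generated over R. The pieces M_n and M_(n+1) are, at
    the price of exactness for large n only: x must map M_(k+1) / M_k injectively to the next
    quotient for all k >= n, and this is where the ascending chain condition enters. The upper bound
    on dim M_n is sharp enough because the relations of the r - m remaining generators, multiplied
    by all monomials of degree <= n - c, give independent linear relations among the spanning
    vectors of M_n; c only absorbs the degrees of these relations. [adjoint], [sqrt_op] and
    [euler_char] are selected values with a default, so each needs an existence proof: Riesz
    representation, a square root of 1 - A for a symmetric contraction A, and the syzygy theorem.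
    After that only the defining properties of the selected values are used. *)

Section FiniteFreeResolutions.
Variable R : comNzRingType.

Definition lker p m (B : 'M[R]_(p, m)) : set 'rV[R]_p := [set u | u *m B = 0].

(* [ffr n S]: there is an exact sequence 0 -> R^(p_n) -> ... -> R^(p_1) -> S -> 0;
   a module R^m / S is represented by its submodule S of relations. *)
Fixpoint ffr (n m : nat) (S : set 'rV[R]_m) : Prop :=
  if n is n'.+1 then
    exists p (B : 'M[R]_(p, m)), S = range (mulmx^~ B) /\ ffr n' (lker B)
  else S = [set 0].

(** S x 0 is isomorphic to S, so the same resolution serves, with zero columns added to its first
    matrix. In [ffr_cone] this places the kernel of one matrix inside the larger free module of the
    cone. *)
Lemma ffr_pad n p q (S : set 'rV[R]_p) : ffr n S ->
  ffr n [set x : 'rV[R]_(p + q) | S (lsubmx x) /\ rsubmx x = 0].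
Proof.
case: n => [|n] /=.
  move=> ->; apply/seteqP; split=> x /=.
    by case=> l0 r0; rewrite -[x]hsubmxK l0 r0 row_mx0.
  by move=> ->; rewrite !linear0.
move=> [r [B [-> Bn]]]; exists r, (row_mx B 0); split.
  apply/seteqP; split=> x /=.
    case=> -[u _ uB] r0; exists u => //.
    by rewrite mul_mx_row mulmx0 -[x]hsubmxK -uB r0.
  by case=> u _ <-; rewrite mul_mx_row mulmx0 row_mxKl row_mxKr; split=> //; exists u.
suff -> : lker (row_mx B (0 : 'M[_]_(r, q))) = lker B by [].
apply/seteqP; split=> x; rewrite /lker /= mul_mx_row mulmx0; last by move=> ->; rewrite row_mx0.
by move=> xB; rewrite -[LHS](row_mxKl _ (0 : 'rV_q)) xB linear0.
Qed.

(* The mapping cone of a map of resolutions, built one step at a time. *)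
Lemma ffr_cone n p q (NE : set 'rV[R]_p) (NF : set 'rV[R]_q) (D : 'M[R]_(p, q)) :
  ffr n NE -> ffr n NF -> (forall w, NF (w *m D) <-> NE w) ->
  ffr n.+1 [set x | exists u w, NF u /\ x = u + w *m D].
Proof.
elim: n p q NE NF D => [|n IHn] p q NE NF D.
  move=> /= NE0 NF0 DP; exists p, D; split; last first.
    rewrite -NE0; apply/seteqP; split=> w /=; rewrite /lker /=.
      by move=> wD; apply/DP; rewrite wD NF0.
    by move/DP; rewrite NF0.
  apply/seteqP; split=> x /=.
    by case=> u [w []]; rewrite NF0 => -> ->; exists w => //; rewrite add0r.
  by case=> w _ <-; exists 0, w; rewrite NF0 add0r.
move=> [p1 [C [NEC Cn]]] [q1 [B [NFB Bn]]] DP.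
(* D carries relations of the source to relations of the target, hence lifts to D'. The sign gives
   D' B + C D = 0, the differential condition of a cone. *)
have /choice[d' dP] (i : 'I_p1) : exists d, d *m B = - row i (C *m D).
  have /DP : NE (row i C) by rewrite NEC; exists (delta_mx 0 i); rewrite -?rowE.
  by rewrite NFB => -[d _ dB]; exists (- d); rewrite mulNmx dB row_mul.
pose D' := \matrix_i d' i.
have D'B : D' *m B = - (C *m D).
  by apply/row_matrixP => i; rewrite row_mul rowK dP linearN.
exists (q1 + p)%N, (col_mx B D); split.
  apply/seteqP; split=> x /=.
    case=> u [w []]; rewrite NFB => -[v _ <-] ->.
    by exists (row_mx v w) => //; rewrite mul_row_col.
  case=> u _ <-; exists (lsubmx u *m B), (rsubmx u); rewrite NFB; split.
    by exists (lsubmx u).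
  by rewrite -mul_row_col hsubmxK.
(* The kernel is again a cone, built from the kernels of C and B along (D' C), so the induction
   hypothesis applies to it. *)
have -> : lker (col_mx B D) = [set x | exists u w,
    [set x : 'rV[R]_(q1 + p) | lker B (lsubmx x) /\ rsubmx x = 0] u
    /\ x = u + w *m row_mx D' C].
  apply/seteqP; split=> x; rewrite /lker /=.
    rewrite -{1}[x]hsubmxK mul_row_col => xBD.
    have /DP : NF (rsubmx x *m D).
      rewrite NFB; exists (- lsubmx x) => //.
      by rewrite mulNmx; apply/eqP; rewrite eq_sym -addr_eq0 addrC xBD.
    rewrite NEC => -[t _ tC].
    exists (row_mx (lsubmx x - t *m D') 0), t; rewrite row_mxKl row_mxKr; split.
      by split=> //; rewrite mulmxBl -mulmxA D'B mulmxN opprK mulmxA tC.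
    by rewrite mul_mx_row tC add_row_mx subrK add0r hsubmxK.
  case=> u [w [[uB u0] ->]]; rewrite -[X in X *m _]hsubmxK mul_row_col.
  rewrite !linearD /= u0 add0r mul_mx_row row_mxKl row_mxKr mulmxDl uB add0r.
  by rewrite -!mulmxA D'B mulmxN addNr.
apply: IHn Cn (ffr_pad p Bn) _ => w; rewrite /lker /= mul_mx_row row_mxKl row_mxKr; split=> [[]//|wC].
by split=> //; rewrite -mulmxA D'B mulmxN mulmxA wC mul0mx oppr0.
Qed.

(** Zero modules can be appended; [ffr_cone] needs two resolutions of equal length. *)
Lemma ffrW n k m (S : set 'rV[R]_m) : ffr n S -> (n <= k)%N -> ffr k S.
Proof.
elim: n k m S => [|n IHn] [|k] m S //=; last first.
  by move=> [p [B [-> Bn]]] nk; exists p, B; split=> //; apply: IHn.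
move=> -> _; exists 0%N, 0; split.
  apply/seteqP; split=> x /=; first by move=> ->; exists 0; rewrite ?mul0mx.
  by case=> u _ <-; rewrite mulmx0.
move: {S} m (0 : 'M[R]_(0, m)); elim: k => [|k IHk] m B /=.
  by apply/seteqP; split=> x /= _; rewrite /lker /= [x]thinmx0 ?mul0mx.
exists 0%N, 0; split.
  apply/seteqP; split=> x; first by exists 0 => //; rewrite [RHS]thinmx0 mul0mx.
  by rewrite /lker /= [x]thinmx0 mul0mx.
exact: IHk.
Qed.

(** Indexing by all of [nat], with zero modules beyond n, matches the shape of [free_resolution].
    The function [rk] reduces to m at 0, so the matrix types agree by computation. *)
Lemma ffr_unroll n m (S : set 'rV[R]_m) : ffr n S ->
  exists r : nat -> nat,
    let rk := fun k => if k is k'.+1 then r k' else m in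
    (forall k, (n < k)%N -> rk k = 0%N) /\
    exists M : (forall k, 'M[R]_(rk k.+1, rk k)), S = range (mulmx^~ (M 0%N)) /\
      forall k (v : 'rV_(rk k.+1)), v *m M k = 0 <-> exists w, w *m M k.+1 = v.
Proof.
elim: n m S => [|n IHn] m S.
  move=> /= ->; exists (fun=> 0%N); split; first by case.
  exists (fun k => 0); split.
    by apply/seteqP; split=> v /= => [->|[u _ <-]]; [exists 0|]; rewrite ?mulmx0.
  by move=> k v; split=> _; [exists 0|]; rewrite ?mulmx0 // [v]thinmx0.
move=> [p [N [-> Nn]]]; have [r [r0 [M [kN ME]]]] := IHn _ _ Nn.
exists (fun k => if k is k'.+1 then r k' else p); split.
  by case=> [|[|k]] // kn; exact: (r0 k.+1).
exists (fun k => match k return 'M[R]_(match k with 0 => p | k'.+1 => r k' end,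
    match k with 0 => m | k'.+1 => match k' with 0 => p | k''.+1 => r k'' end end)
  with 0 => N | k'.+1 => M k' end); split=> //.
case=> [|k] v; last exact: ME.
split=> [vN|[w <-]]; first by have : lker N v by []; rewrite kN => -[w _ <-]; exists w.
by have : lker N (w *m M 0%N) by rewrite kN; exists w.
Qed.


End FiniteFreeResolutions.

(** * Modules given by actions on an abelian group *)

Section Actions.
Variables (R : comNzRingType) (V : zmodType).

(** A predicate on a function rather than a module structure on V: H already carries scalars from
    R[i], and the induction on the variables uses actions of R and R[x] on one group at once. *)
Record is_action (a : R -> V -> V) : Prop := IsAction {
  actionDl : forall f g v, a (f + g) v = a f v + a g v;
  actionDr : forall f u v, a f (u + v) = a f u + a f v;
  actionM : forall f g v, a (f * g) v = a f (a g v);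
  action1 : forall v, a 1 v = v
}.

Definition comb (a : R -> V -> V) q (F : 'I_q -> V) (v : 'rV[R]_q) : V :=
  \sum_(i < q) a (v 0 i) (F i).

Definition fgen (a : R -> V -> V) (S : set V) : Prop :=
  exists r (g : 'I_r -> V), S = range (comb a g).

Variable a : R -> V -> V.
Hypothesis aA : is_action a.

Lemma action0l v : a 0 v = 0.
Proof. by apply: (addIr (a 0 v)); rewrite -(actionDl aA) !add0r. Qed.

Lemma action0r f : a f 0 = 0.
Proof. by apply: (addIr (a f 0)); rewrite -(actionDr aA) !add0r. Qed.

Lemma actionNl f v : a (- f) v = - a f v.
Proof. by apply: (addIr (a f v)); rewrite -(actionDl aA) !addNr action0l. Qed.

Lemma action_sumr (I : Type) (r : seq I) (P : pred I) f (v : I -> V) :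
  a f (\sum_(i <- r | P i) v i) = \sum_(i <- r | P i) a f (v i).
Proof. by apply: (big_morph (a f)) => [x y|]; rewrite ?(actionDr aA) ?action0r. Qed.

Variables (q : nat) (F : 'I_q -> V).

Lemma combD u v : comb a F (u + v) = comb a F u + comb a F v.
Proof. by rewrite -big_split; apply: eq_bigr => i _; rewrite mxE (actionDl aA). Qed.

Lemma combZ f v : comb a F (f *: v) = a f (comb a F v).
Proof. by rewrite action_sumr; apply: eq_bigr => i _; rewrite mxE (actionM aA). Qed.

Lemma comb0 : comb a F 0 = 0.
Proof. by rewrite -(scale0r (0 : 'rV_q)) combZ action0l. Qed.

Lemma combN v : comb a F (- v) = - comb a F v.
Proof. by apply: (addIr (comb a F v)); rewrite -combD !addNr comb0. Qed.

Lemma combB u v : comb a F (u - v) = comb a F u - comb a F v.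
Proof. by rewrite combD combN. Qed.

Lemma comb_sum (I : Type) (r : seq I) (P : pred I) (v : I -> 'rV[R]_q) :
  comb a F (\sum_(i <- r | P i) v i) = \sum_(i <- r | P i) comb a F (v i).
Proof. exact: (big_morph _ combD comb0). Qed.

Lemma comb_delta i : comb a F (delta_mx 0 i) = F i.
Proof.
rewrite /comb (bigD1 i) //= big1 ?addr0 => [|j ji].
  by rewrite mxE !eqxx (action1 aA).
by rewrite mxE (negPf ji) andbF action0l.
Qed.

Lemma comb_mulmx p (M : 'M[R]_(p, q)) (v : 'rV_p) :
  comb a F (v *m M) = comb a (fun i => comb a F (row i M)) v.
Proof.
by rewrite mulmx_sum_row comb_sum; apply: eq_bigr => i _; rewrite combZ.
Qed.

End Actions.

Section Submodules.
Variable R : comNzRingType.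

Definition submodule_set m (K : set 'rV[R]_m) : Prop :=
  [/\ K 0, forall u v, K u -> K v -> K (u + v) & forall f u, K u -> K (f *: u)].

(** Noetherianity of R, stated for chains in every R^m: the chains that occur consist of relations
    in a free module, and in this form the property passes directly to R[x]. *)
Definition acc : Prop := forall m (K : nat -> set 'rV[R]_m),
  (forall k, submodule_set (K k)) -> (forall k, K k `<=` K k.+1) ->
  exists n, forall k, (n <= k)%N -> K k = K n.

(** The syzygy theorem over R. The generators F may be chosen anew, because the mapping cone comes
    with its own. *)
Definition resolvable : Prop := forall (V : zmodType) (a : R -> V -> V),
  is_action a -> forall S, fgen a S ->
  exists q (F : 'I_q -> V), S = range (comb a F) /\
    exists n, ffr n [set v | comb a F v = 0].

Lemma comb_ker_submodule (V : zmodType) (a : R -> V -> V) q (F : 'I_q -> V) :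
  is_action a -> submodule_set [set v | comb a F v = 0].
Proof.
move=> aA; split=> /=; first exact: comb0.
  by move=> u v u0 v0; rewrite combD // u0 v0 addr0.
by move=> f u u0; rewrite combZ // u0 action0r.
Qed.

Lemma chainW (T : Type) (K : nat -> set T) : (forall k, K k `<=` K k.+1) ->
  forall i j, (i <= j)%N -> K i `<=` K j.
Proof.
move=> KS i j /subnK <-; elim: (j - i)%N => [//|k IHk].
exact: subset_trans IHk (KS _).
Qed.

End Submodules.

(** * Vectors over R[x] and their coefficient vectors *)

Section PolynomialVectors.
Variable R : comNzRingType.

Definition coefv m k (v : 'rV[{poly R}]_m) : 'rV[R]_m := map_mx (coefp k) v.
Definition polyv m (c : 'rV[R]_m) : 'rV[{poly R}]_m := map_mx polyC c.
Definition vsize_le m k (v : 'rV[{poly R}]_m) : Prop := forall i, (size (v 0%R i) <= k)%N.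

Lemma coefvE m k (v : 'rV[{poly R}]_m) i : coefv k v 0 i = (v 0 i)`_k.
Proof. by rewrite mxE. Qed.

Lemma coefv_inj m (u v : 'rV[{poly R}]_m) : (forall k, coefv k u = coefv k v) -> u = v.
Proof.
by move=> uv; apply/rowP => i; apply/polyP => k; rewrite -!coefvE uv.
Qed.

Lemma coefvD m k : {morph @coefv m k : u v / u + v}.
Proof. by move=> u v; rewrite /coefv map_mxD. Qed.

Lemma coefvB m k : {morph @coefv m k : u v / u - v}.
Proof. by move=> u v; rewrite /coefv map_mxB. Qed.

Lemma coefv0 m k : @coefv m k 0 = 0.
Proof. exact: map_mx0. Qed.

Lemma coefv_sum m k I (r : seq I) (P : pred I) (u : I -> 'rV[{poly R}]_m) :
  coefv k (\sum_(i <- r | P i) u i) = \sum_(i <- r | P i) coefv k (u i).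
Proof. exact: (big_morph _ (@coefvD m k) (@coefv0 m k)). Qed.

Lemma coefvZ m k c (v : 'rV[{poly R}]_m) : coefv k (c%:P *: v) = c *: coefv k v.
Proof. by apply/rowP => i; rewrite !mxE /= coefCM. Qed.

Lemma coefv_mulX m k (v : 'rV[{poly R}]_m) :
  coefv k ('X *: v) = if k is k'.+1 then coefv k' v else 0.
Proof. by apply/rowP => i; case: k => [|k]; rewrite !mxE /= coefXM. Qed.

Lemma coefv_Xn_polyv m j k (c : 'rV[R]_m) :
  coefv j ('X^k *: polyv c) = if j == k then c else 0.
Proof.
by apply/rowP => i; rewrite !mxE /= coefMC coefXn; case: eqP; rewrite ?mul1r ?mul0r ?mxE.
Qed.

Lemma coefv_mulmx m p k (v : 'rV[{poly R}]_m) (B : 'M[R]_(m, p)) :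
  coefv k (v *m map_mx polyC B) = coefv k v *m B.
Proof.
apply/rowP => i; rewrite !mxE /= coef_sum; apply: eq_bigr => j _.
by rewrite !mxE /= coefMC.
Qed.

Lemma vsize_leP m k (v : 'rV[{poly R}]_m) :
  vsize_le k v <-> forall j, (k <= j)%N -> coefv j v = 0.
Proof.
split=> [vk j kj|v0 i].
  by apply/rowP => i; rewrite coefvE mxE nth_default // (leq_trans (vk i)).
by apply/leq_sizeP => j /v0/rowP/(_ i); rewrite coefvE mxE.
Qed.

Lemma vsize_exists m (v : 'rV[{poly R}]_m) : exists k, vsize_le k v.
Proof.
by exists (\max_i size (v 0%R i))%N => i; rewrite (leq_bigmax i).
Qed.

Lemma vsize0P m (v : 'rV[{poly R}]_m) : vsize_le 0 v <-> v = 0.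
Proof.
split=> [/vsize_leP v0|->]; last by move=> i; rewrite mxE size_poly0.
by apply: coefv_inj => k; rewrite v0 // coefv0.
Qed.

Lemma vsize_leD m k (u v : 'rV[{poly R}]_m) :
  vsize_le k u -> vsize_le k v -> vsize_le k (u + v).
Proof.
move=> /vsize_leP uk /vsize_leP vk; apply/vsize_leP => j kj.
by rewrite coefvD uk // vk // addr0.
Qed.

Lemma vsize_leZ m k c (v : 'rV[{poly R}]_m) : vsize_le k v -> vsize_le k (c%:P *: v).
Proof.
by move=> /vsize_leP vk; apply/vsize_leP => j kj; rewrite coefvZ vk // scaler0.
Qed.

Lemma vsize_leX m k (v : 'rV[{poly R}]_m) : vsize_le k v -> vsize_le k.+1 ('X *: v).
Proof.
by move=> /vsize_leP vk; apply/vsize_leP => -[//|j] kj; rewrite coefv_mulX vk.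
Qed.

Lemma vsize_leW m k j (v : 'rV[{poly R}]_m) : vsize_le k v -> (k <= j)%N -> vsize_le j v.
Proof. by move=> vk kj i; apply: leq_trans kj. Qed.

Lemma vsize_le_Xn m k (c : 'rV[R]_m) : vsize_le k.+1 ('X^k *: polyv c).
Proof.
by apply/vsize_leP => j kj; rewrite coefv_Xn_polyv gtn_eqF.
Qed.

Lemma vsize_leS m k (v : 'rV[{poly R}]_m) : vsize_le k.+1 v ->
  vsize_le k (v - 'X^k *: polyv (coefv k v)).
Proof.
move=> /vsize_leP vk; apply/vsize_leP => j; rewrite leq_eqVlt => /predU1P[<-|kj].
  by rewrite coefvB coefv_Xn_polyv eqxx subrr.
by rewrite coefvB coefv_Xn_polyv gtn_eqF // vk // subr0.
Qed.

Lemma vsize_le_mulmx m p j k (v : 'rV[{poly R}]_m) (W : 'M[{poly R}]_(m, p)) :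
  vsize_le j v -> (forall i, vsize_le k.+1 (row i W)) -> vsize_le (j + k) (v *m W).
Proof.
move=> vj Wk i; rewrite mxE; apply: (leq_trans (size_sum _ _ _)).
apply/bigmax_leqP => l _; have := Wk l i; rewrite mxE => Wli.
apply: (leq_trans (size_polyMleq _ _)); rewrite -ltnS.
case: (posnP (size (v 0 l) + size (W l i))) => [->//|s0].
by rewrite prednK // -addnS leq_add.
Qed.

(** K[x] inside R[x]^m, that is, the relations of R[x] (x) (R^m / K). *)
Definition extv m (K : set 'rV[R]_m) : set 'rV[{poly R}]_m :=
  [set v | forall k, K (coefv k v)].

Lemma lker_ext p m (B : 'M[R]_(p, m)) : lker (map_mx polyC B) = extv (lker B).
Proof.
apply/seteqP; split=> v; rewrite /lker /extv /=.
  by move=> vB k; rewrite -coefv_mulmx vB coefv0.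
by move=> vB; apply: coefv_inj => k; rewrite coefv_mulmx vB coefv0.
Qed.

(** Flatness of R[x] over R, made explicit: a matrix with constant entries acts on each coefficient
    vector separately. *)
Lemma ffr_ext n m (K : set 'rV[R]_m) : ffr n K -> ffr n (extv K).
Proof.
elim: n m K => [|n IHn] m K /=.
  move=> ->; apply/seteqP; split=> v /=; last by move=> -> k; rewrite coefv0.
  by move=> v0; apply: coefv_inj => k; rewrite v0 coefv0.
move=> [p [B [-> Bn]]]; exists p, (map_mx polyC B); split; last first.
  by rewrite lker_ext; apply: IHn.
apply/seteqP; split=> v /=; last first.
  by move=> [u _ <-] k; exists (coefv k u); rewrite // coefv_mulmx.
move=> /= vK; have /choice[u uP] k : exists u, u *m B = coefv k v.
  by have [u _ uP] := vK k; exists u.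
have [N /vsize_leP vN] := vsize_exists v.
exists (\sum_(k < N) 'X^k *: polyv (u k)) => //; apply: coefv_inj => k.
rewrite coefv_mulmx coefv_sum; case: (ltnP k N) => [kN|Nk].
  rewrite (bigD1 (Ordinal kN)) //= coefv_Xn_polyv eqxx big1 ?addr0 ?uP // => i.
  by rewrite -val_eqE /= coefv_Xn_polyv eq_sym => /negPf->.
rewrite big1 ?mul0mx ?vN // => i _.
by rewrite coefv_Xn_polyv gtn_eqF // (leq_trans (ltn_ord i)).
Qed.

(* Hilbert's basis theorem, through modules of leading coefficients. *)
Lemma acc_poly : acc R -> acc {poly R}.
Proof.
move=> accR m K Ksub KS; have KW := chainW KS.
(* Coefficients of x^k in the elements of K j of degree at most k; these sets grow in both
   indices. *)
pose L j k : set 'rV[R]_m :=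
  [set c | exists v, [/\ K j v, vsize_le k.+1 v & coefv k v = c]].
have Lsub j k : submodule_set (L j k).
  have [K0 KD KZ] := Ksub j; split.
  - by exists 0; split; rewrite ?coefv0 // => i; rewrite mxE size_poly0.
  - move=> _ _ [u [uK us <-]] [v [vK vs <-]]; exists (u + v); rewrite coefvD.
    by split; [exact: KD|exact: vsize_leD|].
  - move=> f _ [u [uK us <-]]; exists (f%:P *: u); rewrite coefvZ.
    by split; [exact: KZ|exact: vsize_leZ|].
have LSl j k : L j k `<=` L j.+1 k.
  by move=> _ [u [uK us <-]]; exists u; split=> //; exact: KS.
have LSr j k : L j k `<=` L j k.+1.
  move=> _ [u [uK us <-]]; exists ('X *: u); split; [|exact: vsize_leX|].
    by have [_ _ KZ] := Ksub j; exact: KZ.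
  by rewrite coefv_mulX.
have LW j j' k k' : (j <= j')%N -> (k <= k')%N -> L j k `<=` L j' k'.
  move=> jj kk; apply: (subset_trans (chainW (LSl^~ k) jj)).
  exact: (chainW (LSr j')).
have [|n0 n0P] := accR m (fun n => L n n) (fun n => Lsub n n).
  by move=> n; apply: LW.
have /choice[N NP] k := accR m (L^~ k) (Lsub^~ k) (LSl^~ k).
(* The diagonal chain settles all degrees from n0 on at once; the finitely many smaller ones are
   settled separately. *)
pose J := maxn n0 (\max_(k < n0) N k).
exists J => j Jj; apply/seteqP; split; last exact: KW.
have LJ b : L j b `<=` L J b.
  case: (ltnP b n0) => bn0.
    have NJ : (N b <= J)%N by rewrite leq_max (leq_bigmax (Ordinal bn0)) orbT.
    by rewrite NP ?(leq_trans NJ) // [L J b]NP.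
  apply: (@subset_trans _ (L (maxn j b) (maxn j b))).
    by apply: LW; rewrite ?leq_maxl ?leq_maxr.
  rewrite (n0P (maxn j b)); last by rewrite leq_max bn0 orbT.
  by apply: LW; rewrite ?leq_maxl.
move=> v vK; have [b] := vsize_exists v.
have [K0 KD KZ] := Ksub J; have [_ KDj KZj] := Ksub j.
elim: b v vK => [|b IHb] v vK; first by move=> /vsize0P ->.
(* Subtracting an element of K J with the same top coefficient lowers the degree. *)
move=> vb; have [|w [wK wb wv]] := LJ b (coefv b v); first by exists v.
rewrite -(subrK w v); apply: KD => //; apply: IHb.
  by apply: KDj => //; rewrite -scaleN1r; apply: KZj; apply: KW wK.
apply/vsize_leP => i; rewrite leq_eqVlt => /predU1P[<-|bi].
  by rewrite coefvB wv subrr.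
by rewrite coefvB; move/vsize_leP: vb => ->//; move/vsize_leP: wb => ->//; rewrite subrr.
Qed.

End PolynomialVectors.

(** * The inductive step of the syzygy theorem *)

Section ResolvablePolynomials.
Variable R : comNzRingType.

Lemma fgen_add (V : zmodType) (a : R -> V -> V) (S1 S2 : set V) :
  fgen a S1 -> fgen a S2 -> fgen a [set x | exists u v, [/\ S1 u, S2 v & x = u + v]].
Proof.
move=> [r1 [g1 ->]] [r2 [g2 ->]].
exists (r1 + r2)%N, (fun i => match fintype.split i with inl j => g1 j | inr j => g2 j end).
have combE v : comb a (fun i => match fintype.split i with inl j => g1 j | inr j => g2 j end) v
    = comb a g1 (lsubmx v) + comb a g2 (rsubmx v).
  rewrite /comb big_split_ord /=; congr (_ + _); apply: eq_bigr => i _; rewrite mxE.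
    by rewrite -[lshift _ _]/(unsplit (inl i)) unsplitK.
  by rewrite -[rshift _ _]/(unsplit (inr i)) unsplitK.
apply/seteqP; split=> x /=.
  move=> [_ [_ [[v1 _ <-] [v2 _ <-] ->]]]; exists (row_mx v1 v2) => //.
  by rewrite combE row_mxKl row_mxKr.
move=> [v _ <-]; rewrite combE.
by exists (comb a g1 (lsubmx v)), (comb a g2 (rsubmx v)); split=> //;
  [exists (lsubmx v) | exists (rsubmx v)].
Qed.

Variables (V : zmodType) (a : {poly R} -> V -> V).
Hypothesis aA : is_action a.
Let aR (c : R) := a c%:P.

Lemma is_action_polyC : is_action aR.
Proof.
split=> *; rewrite /aR ?polyCD ?polyCM ?polyC1;
  by rewrite ?(actionDl aA) ?(actionDr aA) ?(actionM aA) ?(action1 aA).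
Qed.
Let aRA := is_action_polyC.

Lemma actionC f g v : a f (a g v) = a g (a f v).
Proof. by rewrite -!(actionM aA) mulrC. Qed.

Lemma comb_polyv q (F : 'I_q -> V) c : comb a F (polyv c) = comb aR F c.
Proof. by apply: eq_bigr => i _; rewrite mxE. Qed.

Lemma comb_ext_ker q (F : 'I_q -> V) v :
  extv [set c | comb aR F c = 0] v -> comb a F v = 0.
Proof.
move=> vK; have [k] := vsize_exists v.
elim: k v vK => [|k IHk] v vK; first by move=> /vsize0P ->; rewrite (comb0 aA).
move=> vk; rewrite -[v](subrK ('X^k *: polyv (coefv k v))) (combD aA) (combZ aA).
rewrite comb_polyv vK (action0r aA) addr0; apply: IHk; last exact: vsize_leS.
move=> j; rewrite /= coefvB coefv_Xn_polyv (combB aRA) vK.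
by case: eqP => [_|_]; rewrite ?vK ?(comb0 aRA) subrr.
Qed.

Variables (r : nat) (g : 'I_r -> V).

(* The part of the module generated by g over polynomials of degree < k. *)
Let M k : set V := [set x | exists v, vsize_le k v /\ x = comb a g v].
(** The relations of M (k+1) / M k on the generators x^k g_i. They increase with k since x maps each
    quotient onto the next; once they are constant, these maps are injective. *)
Let K k : set 'rV[R]_r := [set c | M k (a 'X^k (comb aR g c))].

Let M_D k x y : M k x -> M k y -> M k (x + y).
Proof.
move=> [u [uk ->]] [v [vk ->]]; exists (u + v).
by rewrite (combD aA); split=> //; exact: vsize_leD.
Qed.

Let M_Z k c x : M k x -> M k (aR c x).
Proof.
move=> [u [uk ->]]; exists (c%:P *: u).
by rewrite (combZ aA); split=> //; exact: vsize_leZ.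
Qed.

Let M_N k x : M k x -> M k (- x).
Proof. by move=> /(M_Z (- 1)); rewrite (actionNl aRA) (action1 aRA). Qed.

Let M_X k x : M k x -> M k.+1 (a 'X x).
Proof.
move=> [u [uk ->]]; exists ('X *: u).
by rewrite (combZ aA); split=> //; exact: vsize_leX.
Qed.

Let M_Xn k n x : M k x -> M (k + n) (a 'X^n x).
Proof.
elim: n => [|n IHn] Mx; first by rewrite addn0 expr0 (action1 aA).
by rewrite exprS (actionM aA) addnS; apply/M_X/IHn.
Qed.

Let M_W k j x : M k x -> (k <= j)%N -> M j x.
Proof. by move=> [v [vk ->]] kj; exists v; split=> //; apply: vsize_leW kj. Qed.

Let M_S k x : M k.+1 x -> exists c y, M k y /\ x = y + a 'X^k (comb aR g c).
Proof.
move=> [v [vk ->]]; exists (coefv k v), (comb a g (v - 'X^k *: polyv (coefv k v))).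
split; first by exists (v - 'X^k *: polyv (coefv k v)); split=> //; exact: vsize_leS.
by rewrite (combB aA) (combZ aA) comb_polyv subrK.
Qed.

Let M_fgen k : fgen aR (M k).
Proof.
elim: k => [|k IHk].
  exists 0%N, (fun=> 0); apply/seteqP; split=> x.
    by move=> [v [/vsize0P -> ->]]; exists 0; rewrite // (comb0 aA) (comb0 aRA).
  by move=> [v _ <-]; exists 0; rewrite vsize0P (comb0 aA) /comb big_ord0.
suff -> : M k.+1 = [set x | exists u v,
    [/\ M k u, range (comb aR (fun i => a 'X^k (g i))) v & x = u + v]].
  by apply: fgen_add IHk _; exists r, (fun i => a 'X^k (g i)).
have combX c : comb aR (fun i => a 'X^k (g i)) c = a 'X^k (comb aR g c).
  by rewrite (action_sumr aA); apply: eq_bigr => i _; rewrite /aR actionC.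
apply/seteqP; split=> x.
  move=> /M_S [c [y [yM ->]]]; exists y, (a 'X^k (comb aR g c)); split=> //.
  by exists c; rewrite // combX.
move=> [u [_ [uM [c _ <-] ->]]]; apply: M_D; first exact: M_W uM (leqnSn k).
rewrite combX; exists ('X^k *: polyv c); rewrite (combZ aA) comb_polyv.
by split=> //; exact: vsize_le_Xn.
Qed.

Lemma resolvable_poly_step : acc R -> resolvable R ->
  exists q (F : 'I_q -> V), range (comb a g) = range (comb a F) /\
    exists n, ffr n [set v | comb a F v = 0].
Proof.
move=> accR resR.
have Ksub k : submodule_set (K k).
  split.
  - exists 0; rewrite (comb0 aA) (comb0 aRA) (action0r aA).
    by split=> // i; rewrite mxE size_poly0.
  - move=> u v uK vK; rewrite /K /= (combD aRA) (actionDr aA).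
    exact: M_D.
  - by move=> f u uK; rewrite /K /= (combZ aRA) actionC; apply: M_Z.
have KS k : K k `<=` K k.+1.
  by move=> c cK; rewrite /K /= exprS (actionM aA); apply: M_X.
have [n nP] := accR _ _ Ksub KS.
(* Multiplication by 'X is injective on the quotients M (k+1) / M k, k >= n. *)
have Minj j x : M n.+1 x -> M (n + j) (a 'X^j x) -> M n x.
  move=> /M_S [c [y [yM ->]]]; rewrite (actionDr aA) => jM.
  have : K (n + j) c.
    rewrite /K /= addnC exprD (actionM aA) addnC -[X in M _ X](addKr (a 'X^j y)).
    by apply: M_D => //; apply: M_N; apply: M_Xn.
  by rewrite nP ?leq_addr // => cK; apply: M_D.
(* E and F generate M_n and M_(n+1) over R. Below, I and X are the matrices of the inclusion and of
   multiplication by x from M_n to M_(n+1). *)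
have [p [E [ME [n1 kE]]]] := resR V aR aRA _ (M_fgen n).
have [q [F [MF [n2 kF]]]] := resR V aR aRA _ (M_fgen n.+1).
have EM i : M n (E i) by rewrite ME; exists (delta_mx 0 i); rewrite ?(comb_delta aRA).
have FM i : M n.+1 (F i) by rewrite MF; exists (delta_mx 0 i); rewrite ?(comb_delta aRA).
have /choice[X' X'P] i : exists c, comb aR F c = a 'X (E i).
  by have := M_X (EM i); rewrite MF => -[c _ <-]; exists c.
have /choice[I' I'P] i : exists c, comb aR F c = E i.
  by have := M_W (EM i) (leqnSn n); rewrite MF => -[c _ <-]; exists c.
pose X := \matrix_i X' i; pose I := \matrix_i I' i.
have combI e : comb aR F (e *m I) = comb aR E e.
  by rewrite (comb_mulmx aRA); apply: eq_bigr => i _; rewrite rowK I'P.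
have combX e : comb aR F (e *m X) = a 'X (comb aR E e).
  rewrite (comb_mulmx aRA) (action_sumr aA); apply: eq_bigr => i _.
  by rewrite rowK X'P actionC.
(* With S = R[x], D presents m |-> x (x) m - 1 (x) x m in the exact sequence
   0 -> S (x) M_n -> S (x) M_(n+1) -> M -> 0. *)
pose D : 'M[{poly R}]_(p, q) := 'X *: map_mx polyC I - map_mx polyC X.
have coefD k w : coefv k (w *m D)
    = (if k is k'.+1 then coefv k' w else 0) *m I - coefv k w *m X.
  rewrite mulmxBr coefvB coefv_mulmx -scalemxAr scalemxAl coefv_mulmx coefv_mulX.
  by [].
have combD0 w : comb a F (w *m D) = 0.
  rewrite (comb_mulmx aA); apply: big1 => i _.
  rewrite [X in a _ X](_ : _ = 0) ?(action0r aA) //.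
  rewrite linearB /= linearZ /= -!map_row (combB aA) (combZ aA).
  by rewrite !comb_polyv !rowK I'P X'P subrr.
have /choice[W WP] i : exists v, vsize_le n.+1 v /\ F i = comb a g v by exact: FM.
have combW v : comb a F v = comb a g (v *m \matrix_i W i).
  by rewrite (comb_mulmx aA); apply: eq_bigr => i _; rewrite rowK; case: (WP i) => _ ->.
exists q, F; split.
  apply/seteqP; split=> x [v _ <-]; last by exists (v *m \matrix_i W i).
  (* M_(n+1), even for n = 0, contains the generators g_i, so F generates the whole module over
     R[x]. *)
  have /choice[C CP] i : exists c, comb aR F c = g i.
    have : M n.+1 (g i).
      apply: (@M_W 1) => //; exists (polyv (delta_mx 0 i)).
      rewrite comb_polyv (comb_delta aRA); split=> //.
      by rewrite -[polyv _]scale1r -(expr0 'X); exact: vsize_le_Xn.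
    by rewrite MF => -[c _ <-]; exists c.
  exists (v *m map_mx polyC (\matrix_i C i)) => //.
  rewrite (comb_mulmx aA); apply: eq_bigr => i _.
  by rewrite -map_row rowK -/(polyv _) comb_polyv CP.
exists (maxn n1 n2).+1.
have -> : [set v | comb a F v = 0] = [set x | exists u w,
    extv [set c | comb aR F c = 0] u /\ x = u + w *m D].
  apply/seteqP; split=> v /=; last first.
    by move=> [u [w [uK ->]]]; rewrite (combD aA) combD0 addr0 comb_ext_ker.
  (* Exactness in the middle, by descent on the degree of v. A constant v is already a relation over
     R. Otherwise the top coefficient represents an element of M_n by [Minj], hence equals e I up to
     a relation over R, and subtracting x^k e D together with that relation lowers the degree. *)
  have [k] := vsize_exists v; elim: k v => [|k IHk] v.
    move=> /vsize0P -> _; exists 0, 0; rewrite mul0mx addr0; split=> // k.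
    by rewrite coefv0 /= (comb0 aRA).
  move=> vk v0; pose c := coefv k v; pose v' : 'rV[{poly R}]_q := v - 'X^k *: polyv c.
  have v'k : vsize_le k v' by exact: vsize_leS.
  have cv' : a 'X^k (comb aR F c) = - comb a F v'.
    by rewrite (combB aA) v0 sub0r opprK (combZ aA) comb_polyv.
  case: k => [|k] in vk c v' v'k cv' IHk *.
    exists v, 0; rewrite mul0mx addr0; split=> // -[|j]; last first.
      by move/vsize_leP: vk => -> //=; rewrite (comb0 aRA).
    move/vsize0P: v'k cv' => ->; rewrite (comb0 aA) oppr0 expr0 (action1 aA).
    by [].
  have : M n (comb aR F c).
    apply: (@Minj k.+1); first by rewrite MF; exists c.
    rewrite cv' addnC; apply: M_N; rewrite combW.
    exists (v' *m \matrix_i W i); split=> //; apply: vsize_le_mulmx => // i.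
    by rewrite rowK; case: (WP i).
  rewrite ME => -[e _ eE].
  have cI : comb aR F (c - e *m I) = 0 by rewrite (combB aRA) combI eE subrr.
  pose t : 'rV[{poly R}]_p := 'X^k *: polyv e.
  have [||u [w [uK uE]]] := IHk (v - t *m D - 'X^(k.+1) *: polyv (c - e *m I)).
  - apply/vsize_leP => j; rewrite leq_eqVlt => kj.
    rewrite !coefvB coefD coefv_Xn_polyv; case/predU1P: kj => [<-|kj].
      rewrite eqxx coefv_Xn_polyv eqxx coefv_Xn_polyv eqn_leq ltnn mul0mx subr0.
      by rewrite -/c subrr.
    rewrite gtn_eqF //; case: j kj => // j kj.
    rewrite !coefv_Xn_polyv !gtn_eqF //; last exact: ltnW.
    by rewrite !mul0mx !subr0; move/vsize_leP: vk => ->.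
  - rewrite !(combB aA) v0 combD0 (combZ aA) comb_polyv cI (action0r aA).
    by rewrite !subr0.
  - exists (u + 'X^(k.+1) *: polyv (c - e *m I)), (w + t); split; last first.
      by rewrite mulmxDl addrACA -uE addrA !subrK.
    move=> j; rewrite coefvD /= (combD aRA) uK add0r coefv_Xn_polyv.
    by case: eqP => _; rewrite ?cI ?(comb0 aRA).
apply: ffr_cone (ffr_ext (ffrW kE (leq_maxl _ _))) (ffr_ext (ffrW kF (leq_maxr _ _))) _.
move=> w; split=> wK k; last first.
  rewrite coefD /= (combB aRA) combI combX wK (action0r aA) subr0.
  by case: k => [|k]; rewrite ?wK ?(comb0 aRA).
(* Injectivity of the map given by D: the coefficients of w represent elements e_j of M_n with e_j =
   x e_(j+1). They vanish in high degree, hence everywhere. *)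
have step j : comb aR E (coefv j w) = a 'X (comb aR E (coefv j.+1 w)).
  apply/eqP; rewrite -subr_eq0 -combI -combX -(combB aRA).
  by have := wK j.+1; rewrite coefD => /eqP.
have [N /vsize_leP wN] := vsize_exists w.
have : comb aR E (coefv (N + k) w) = 0 by rewrite wN ?leq_addr // (comb0 aRA).
rewrite addnC; elim: N {wN} => [|N IHN]; first by rewrite addn0.
by rewrite addnS => kN; apply: IHN; rewrite step kN (action0r aA).
Qed.

End ResolvablePolynomials.

Lemma resolvable_poly (R : comNzRingType) :
  acc R -> resolvable R -> resolvable {poly R}.
Proof.
move=> accR resR V a aA _ [r [g ->]].
exact: resolvable_poly_step.
Qed.

(** * The base case: vector spaces *)

Section FieldModules.
Variable K : fieldType.

Lemma submodule_rowspan m (S : set 'rV[K]_m) : submodule_set S ->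
  exists r (B : 'M[K]_(r, m)), row_free B /\ S = range (mulmx^~ B).
Proof.
move=> [S0 SD SZ].
(* Among the matrices whose row space lies in S, one of maximal rank is chosen; adjoining a vector
   of S cannot increase the rank. *)
pose P k := `[< exists B : 'M[K]_m, (forall u, S (u *m B)) /\ \rank B = k >].
have exP : exists k, P k.
  by exists 0%N; apply/asboolP; exists 0; rewrite mxrank0; split=> // u; rewrite mulmx0.
have ubP k : P k -> (k <= m)%N by move=> /asboolP[B [_ <-]]; exact: rank_leq_row.
case: (ex_maxnP exP ubP) => k /asboolP[B [SB rB]] kmax.
have SSB v : S v -> (v <= B)%MS.
  move=> Sv; have rBv : (\rank (B + v)%MS <= \rank B)%N.
    rewrite rB; apply: kmax; apply/asboolP; exists (B + v)%MS; split=> // u.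
    have /sub_addsmxP[[u1 u2] ->] : (u *m (B + v)%MS <= B + v)%MS by exact: submxMl.
    by apply: SD => //=; rewrite [u2]mx11_scalar mul_scalar_mx; exact: SZ.
  have := mxrank_leqif_eq (addsmxSl B v); rewrite /leqif => -[le].
  rewrite eqn_leq le rBv => /esym/andP[_].
  exact: submx_trans (addsmxSr _ _).
exists (\rank B), (row_base B); split; first exact: row_base_free.
apply/seteqP; split=> v.
  by move=> /SSB; rewrite -(eq_row_base B) => /submxP[u ->]; exists u.
move=> [u _ <-]; have : (u *m row_base B <= B)%MS.
  by apply: submx_trans (submxMl _ _) _; rewrite eq_row_base.
by move=> /submxP[w ->].
Qed.

Lemma acc_field : acc K.
Proof.
move=> m S Ssub SS; have SW := chainW SS.
pose U : set 'rV[K]_m := [set v | exists k, S k v].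
have Usub : submodule_set U.
  split.
  - by exists 0%N; case: (Ssub 0%N).
  - move=> u v [i Siu] [j Sjv]; exists (maxn i j); have [_ SD _] := Ssub (maxn i j).
    by apply: SD; [apply: SW Siu; rewrite leq_maxl|apply: SW Sjv; rewrite leq_maxr].
  - by move=> f u [i Siu]; exists i; have [_ _ SZ] := Ssub i; exact: SZ.
have [r [B [_ UB]]] := submodule_rowspan Usub.
have /choice[N NP] i : exists k, S k (row i B).
  have : U (row i B) by rewrite UB; exists (delta_mx 0 i); rewrite // -rowE.
  by [].
exists (\max_i N i)%N => k Nk; apply/seteqP; split; last exact: SW.
move=> v Sv; have : U v by exists k.
rewrite UB => -[u _ <-]; rewrite mulmx_sum_row.
have [S0 SD SZ] := Ssub (\max_i N i)%N.
apply: (big_ind (S (\max_i N i)%N)) => // i _; apply: SZ.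
by apply: SW (NP i); rewrite leq_bigmax.
Qed.

(** Over a field the relations have a basis, so the resolution stops after one step. *)
Lemma resolvable_field : resolvable K.
Proof.
move=> V a aA _ [r [g ->]]; exists r, g; split=> //.
have [q [B [Bfree kB]]] := submodule_rowspan (comb_ker_submodule g aA).
exists 1%N, q, B; split=> //; apply/seteqP; split=> u; rewrite /lker /=.
  by move=> uB; apply: (row_free_inj Bfree); rewrite /= uB mul0mx.
by move=> ->; rewrite mul0mx.
Qed.

End FieldModules.

(** * Transport along a ring isomorphism *)

Section Transport.
Variables (R S : comNzRingType) (f : {rmorphism R -> S}) (h : S -> R).
Hypotheses (fK : cancel f h) (hK : cancel h f).

Lemma map_mxfK m n : cancel (@map_mx _ _ f m n) (map_mx h).
Proof. by move=> A; apply/matrixP => i j; rewrite !mxE fK. Qed.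

Lemma map_mxhK m n : cancel (@map_mx _ _ h m n) (map_mx f).
Proof. by move=> A; apply/matrixP => i j; rewrite !mxE hK. Qed.

Lemma acc_transport : acc R -> acc S.
Proof.
move=> accR m K Ksub KS.
have [k||n nP] := accR m (fun k => [set u | K k (map_mx f u)]).
- have [K0 KD KZ] := Ksub k; split=> /= [|u v uK vK|c u uK]; first by rewrite map_mx0.
    by rewrite map_mxD; exact: KD.
  by rewrite map_mxZ; exact: KZ.
- by move=> k u; exact: KS.
exists n => k nk; apply/seteqP; split=> v; rewrite -[v]map_mxhK => vK.
  by have := nP k nk => /seteqP[+ _]; exact.
by have := nP k nk => /seteqP[_]; exact.
Qed.

Lemma ffr_transport n m (K : set 'rV[R]_m) : ffr n K -> ffr n [set v | K (map_mx h v)].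
Proof.
elim: n m K => [|n IHn] m K /=.
  move=> ->; apply/seteqP; split=> v /= => [v0|->].
    by rewrite -[v]map_mxhK v0 map_mx0.
  by rewrite -(map_mx0 f) map_mxfK.
move=> [p [B [-> Bn]]]; exists p, (map_mx f B); split.
  apply/seteqP; split=> v /=.
    by move=> [u _ uv]; exists (map_mx f u); rewrite -?map_mxM ?uv ?map_mxhK.
  by move=> [u _ <-]; exists (map_mx h u); rewrite // -[u in RHS]map_mxhK -map_mxM map_mxfK.
suff -> : lker (map_mx f B) = [set v | lker B (map_mx h v)] by exact: IHn.
apply/seteqP; split=> v; rewrite /lker /=.
  rewrite -{1}[v]map_mxhK -map_mxM => /(congr1 (map_mx h)).
  by rewrite map_mxfK -(map_mx0 f) map_mxfK.
by move=> vB; rewrite -[v]map_mxhK -map_mxM vB map_mx0.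
Qed.

Lemma resolvable_transport : resolvable R -> resolvable S.
Proof.
move=> resR V a aA _ [r [g ->]]; pose b c := a (f c).
have bA : is_action b.
  split=> *; rewrite /b ?rmorphD ?rmorphM ?rmorph1;
  by rewrite ?(actionDl aA) ?(actionDr aA) ?(actionM aA) ?(action1 aA).
have combE q (F : 'I_q -> V) v : comb a F v = comb b F (map_mx h v).
  by apply: eq_bigr => i _; rewrite /b mxE hK.
have rangeE q (F : 'I_q -> V) : range (comb a F) = range (comb b F).
  apply/seteqP; split=> x [v _ <-]; first by exists (map_mx h v).
  by exists (map_mx f v); rewrite // combE map_mxfK.
have [|q [F [gF [n kF]]]] := resR V b bA (range (comb b g)); first by exists r, g.
exists q, F; rewrite !rangeE; split=> //; exists n.
have := ffr_transport kF; congr ffr; apply/seteqP.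
by split=> v /=; rewrite combE.
Qed.

End Transport.

(** * Polynomials in n + 1 variables as polynomials in the last one *)

Section MultivariatePolynomials.
Variables (K : comNzRingType) (n : nat).

Definition unmuni (p : {poly mpoly n K}) : mpoly n.+1 K :=
  horner_eval (mpolyX K (mnm1 ord_max)) (mpwiden p).

HB.instance Definition _ :=
  GRing.RMorphism.copy unmuni (horner_eval (mpolyX K (mnm1 (@ord_max n))) \o @mpwiden n K).

Lemma muniK : cancel (@muni n K) unmuni.
Proof.
move=> p; rewrite muniE raddf_sum /= [RHS]mpolyE; apply: eq_bigr => m _.
rewrite /unmuni mpwidenZ rmorphXn /= mpwidenX /horner_eval hornerZ hornerXn.
rewrite mwidenZ mwidenX mpolyXn -scalerAl -mpolyXD; congr (_ *: mpolyX _ _).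
apply/mnmP => i; rewrite mnmDE mulmnE mnm1E.
case: (unliftP ord_max i) => [j ->|->].
  rewrite (_ : lift ord_max j = widen_ord (leqnSn n) j); last first.
    by apply: val_inj; rewrite /= /bump leqNgt ltn_ord.
  rewrite mnmwiden_widen mnmE (_ : _ == _ = false) ?mul0n ?addn0 //.
  by rewrite -val_eqE /= gtn_eqF.
by rewrite mnmwiden_ordmax eqxx mul1n.
Qed.

Lemma unmuniK : cancel unmuni (@muni n K).
Proof.
have muniX m : muni (mpolyX K m) =
    mpolyX K (Multinom [tuple m (widen_ord (leqnSn n) i) | i < n]) *: 'X^(m ord_max).
  by rewrite muniE msuppX big_seq1 mcoeffX eqxx scale1r.
have muni_widen (p : mpoly n K) : muni (mwiden p) = p%:P.
  transitivity (\sum_(m <- msupp p) (mcoeff m p *: mpolyX K m)%:P); last first.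
    by rewrite -raddf_sum -mpolyE.
  rewrite [in LHS](mpolyE p) (raddf_sum (@mwiden n K)) (raddf_sum (@muni n K)).
  apply: eq_bigr => m _ /=.
  rewrite mwidenZ mwidenX muniZ muniX mnmwiden_ordmax expr0 alg_polyC.
  rewrite -mul_polyC -polyCM mul_mpolyC; congr ((_ *: mpolyX _ _)%:P).
  by apply/mnmP => i; rewrite mnmE mnmwiden_widen.
have muniXn c i : muni (unmuni (c *: 'X^i)) = c *: 'X^i.
  rewrite /unmuni mpwidenZ rmorphXn /= mpwidenX /horner_eval hornerZ hornerXn.
  rewrite muniM muni_widen rmorphXn /= muniX mul_polyC mnm1E eqxx expr1.
  rewrite (_ : Multinom _ = mnm0) ?mpolyX0 ?scale1r //.
  apply/mnmP => j; rewrite mnmE mnm1E mnm0E; apply/eqP.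
  by rewrite eqb0 -val_eqE /= gtn_eqF.
move=> p; rewrite -[RHS]coefK -[in LHS](coefK p) poly_def !raddf_sum /=.
by apply: eq_bigr => i _; exact: muniXn.
Qed.

End MultivariatePolynomials.

Lemma mpolyC0K (K : comNzRingType) : cancel (@mpolyC 0 K) (mcoeff (@mnm0 0)).
Proof. by move=> c; rewrite mcoeffC eqxx mulr1. Qed.

Lemma mpoly0K (K : comNzRingType) : cancel (mcoeff (@mnm0 0)) (@mpolyC 0 K).
Proof.
move=> p; rewrite -msize1_polyC // msizeE; apply/bigmax_leqP_seq => m _ _.
by rewrite mdegE big_ord0.
Qed.

(** Both properties are carried together, since resolving over R[x] uses the chain condition over
    R. *)
Lemma acc_resolvable_mpoly (K : fieldType) n :
  acc (mpoly n K) /\ resolvable (mpoly n K).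
Proof.
elim: n => [|n [accn resn]].
  split; first exact: (acc_transport (@mpoly0K K) (@acc_field K)).
  exact: (resolvable_transport (@mpolyC0K K) (@mpoly0K K) (@resolvable_field K)).
split; first exact: (acc_transport (@muniK K n) (acc_poly accn)).
exact: (resolvable_transport (@unmuniK K n) (@muniK K n) (resolvable_poly accn resn)).
Qed.

(** * Euler characteristic and rank over the fraction field *)

Section FractionRank.
Variable A : idomainType.
Local Notation K := {fraction A}.
Local Notation frac_mx := (map_mx (@tofrac A)).

Lemma fraction_denom (x : K) : exists d n : A, d != 0 /\ tofrac d * x = tofrac n.
Proof.
elim/quotW: x => x; exists (frac x).2, (frac x).1; split; first exact: denom_ratioP.
unlock tofrac; rewrite -[LHS]FracField.pi_mul; apply/eqmodP.
rewrite /= FracField.equivfE /FracField.mulf.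
by rewrite !numden_Ratio ?mul1r ?mulr1 ?oner_eq0 ?denom_ratioP // mulrC.
Qed.

Lemma clear_denom m (v : 'rV[K]_m) :
  exists c w, c != 0 /\ tofrac c *: v = frac_mx w.
Proof.
have /choice[d /choice[n dnP]] i := fraction_denom (v 0 i).
exists (\prod_i d i), (\row_i (n i * \prod_(j | j != i) d j)); split.
  by apply/prodf_neq0 => i _; case: (dnP i).
apply/rowP => i; rewrite !mxE (bigD1 i) //= !tofracM mulrAC.
by case: (dnP i) => _ ->.
Qed.

Lemma frac_mx_inj m n : injective (frac_mx : 'M[A]_(m, n) -> 'M[K]_(m, n)).
Proof.
move=> M N MN; apply/matrixP => i j; apply/eqP; rewrite -tofrac_eq; apply/eqP.
by move/matrixP/(_ i j): MN; rewrite !mxE.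
Qed.

Lemma frac_submxP p m (B : 'M[A]_(p, m)) (v : 'rV[K]_m) :
  (exists c u, c != 0 /\ tofrac c *: v = frac_mx (u *m B)) -> (v <= frac_mx B)%MS.
Proof.
move=> [c [u [c0 cv]]]; rewrite -(eqmx_scale v (_ : tofrac c != 0)) ?tofrac_eq0 //.
by rewrite cv map_mxM submxMl.
Qed.

(** Clearing denominators turns a kernel vector over the fraction field into one over A, where
    exactness applies; the rest is the rank-nullity formula. *)
Lemma frac_rank_exact p q s (B : 'M[A]_(q, p)) (C : 'M[A]_(s, q)) :
  (forall v : 'rV_q, v *m B = 0 <-> exists w, w *m C = v) ->
  (\rank (frac_mx B) + \rank (frac_mx C))%N = q.
Proof.
move=> BC; suff /eqmxP -> : (frac_mx C == kermx (frac_mx B))%MS.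
  by rewrite mxrank_ker subnKC // rank_leq_row.
apply/andP; split.
  apply/sub_kermxP; rewrite -map_mxM [X in frac_mx X](_ : _ = 0) ?map_mx0 //.
  apply/row_matrixP => i; rewrite row_mul row0; apply/BC.
  by exists (delta_mx 0 i); rewrite -rowE.
apply/rV_subP => v /sub_kermxP vB; apply: frac_submxP.
have [c [w [c0 cv]]] := clear_denom v.
have /BC[u uw] : w *m B = 0.
  by apply: frac_mx_inj; rewrite map_mxM -cv -scalemxAl vB scaler0 map_mx0.
by exists c, u; rewrite uw.
Qed.

Variables (rk : nat -> nat) (L : nat) (B : forall k, 'M[A]_(rk k.+1, rk k)).
Hypothesis rk0 : forall k, (L <= k)%N -> rk k = 0%N.
Hypothesis BE : forall k (v : 'rV_(rk k.+1)),
  v *m B k = 0 <-> exists w, w *m B k.+1 = v.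
Variables (V : zmodType) (a : A -> V -> V) (aug : 'rV[A]_(rk 0) -> V).
Hypothesis aA : is_action a.
Hypothesis augD : forall u v, aug (u + v) = aug u + aug v.
Hypothesis augZ : forall f v, aug (f *: v) = a f (aug v).
Hypothesis augE : forall v, aug v = 0 <-> exists w, w *m B 0 = v.
(* A maximal linearly independent family in the module resolved by B. *)
Variables (m : nat) (e : 'I_m -> V).
Hypothesis e_aug : forall i, range aug (e i).
Hypothesis e_free : forall v, comb a e v = 0 -> v = 0.
Hypothesis e_max : forall v, exists f w, f != 0 /\ a f (aug v) = comb a e w.

(** Over the fraction field, lifts E of the family e span a complement of the row space of B 0:
    independence of e makes the intersection trivial, maximality makes the sum everything. *)
Lemma frac_rank_aug : (m + \rank (frac_mx (B 0)))%N = rk 0.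
Proof.
have /choice[E' E'P] i : exists v, aug v = e i by case: (e_aug i) => v _ <-; exists v.
pose E := \matrix_i E' i.
have aug0 : aug 0 = 0 by apply: (addIr (aug 0)); rewrite -augD !add0r.
have augE' v : aug (v *m E) = comb a e v.
  rewrite mulmx_sum_row (big_morph _ augD aug0); apply: eq_bigr => i _.
  by rewrite augZ rowK E'P.
have vE0 (v : 'rV[K]_m) : (v *m frac_mx E <= frac_mx (B 0))%MS -> v = 0.
  (* One common denominator for v and u, so that the relation between them descends to A. *)
  move=> /submxP[u vu]; have [c [w [c0 cw]]] := clear_denom (row_mx v u).
  have [cv cu] : tofrac c *: v = frac_mx (lsubmx w) /\ tofrac c *: u = frac_mx (rsubmx w).
    move: cw; rewrite scale_row_mx -[w in frac_mx w]hsubmxK map_row_mx.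
    by move/eq_row_mx => [-> ->].
  have wE : lsubmx w *m E = rsubmx w *m B 0.
    by apply: frac_mx_inj; rewrite !map_mxM -cv -cu -!scalemxAl vu.
  have w0 : lsubmx w = 0.
    by apply: e_free; rewrite -augE' wE; apply/augE; exists (rsubmx w).
  apply/eqP; move/eqP: cv; rewrite w0 map_mx0 scaler_eq0 tofrac_eq0.
  by rewrite (negPf c0).
have Efree : \rank (frac_mx E) = m.
  apply/eqP; rewrite -/(row_free _) -kermx_eq0; apply/eqP/row_matrixP => i.
  rewrite row0; apply: vE0; rewrite -row_mul mulmx_ker row0; exact: sub0mx.
have capE : (frac_mx E :&: frac_mx (B 0) = 0)%MS.
  apply/eqP; rewrite -submx0; apply/rV_subP => v; rewrite sub_capmx => /andP[].
  by move=> /submxP[u ->] /vE0 ->; rewrite mul0mx sub0mx.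
rewrite -[X in (X + _)%N]Efree -mxrank_disjoint_sum //.
apply/eqP; rewrite -/(row_full _) -sub1mx; apply/row_subP => i.
have [f [w [f0 fw]]] := e_max (delta_mx 0 i).
have /augE[u uE] : aug (f *: delta_mx 0 i - w *m E) = 0.
  by rewrite -scaleN1r augD !augZ augE' fw (actionNl aA) (action1 aA) subrr.
rewrite rowE mulmx1 -(eqmx_scale _ (_ : tofrac f != 0)) ?tofrac_eq0 //.
rewrite -(subrK (frac_mx (w *m E)) (tofrac f *: _)) addrC.
apply: addmx_sub_adds; first by rewrite map_mxM submxMl.
suff -> : tofrac f *: delta_mx 0 i - frac_mx (w *m E) = frac_mx (u *m B 0).
  by rewrite map_mxM submxMl.
by rewrite uE map_mxB map_mxZ map_delta_mx.
Qed.

Lemma euler_sum : \sum_(k < L) (-1) ^+ k * (rk k)%:Z = m%:Z.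
Proof.
(* The sum cut off after n misses m only by the rank of B n up to sign, and this rank is 0 at n = L
   because rk (L + 1) = 0. *)
have H n : \sum_(k < n.+1) (-1) ^+ k * (rk k)%:Z =
    m%:Z + (-1) ^+ n * (\rank (frac_mx (B n)))%:Z.
  elim: n => [|n IHn].
    by rewrite big_ord_recr big_ord0 /= add0r !expr0 !mul1r -PoszD frac_rank_aug.
  have /(congr1 Posz)/esym := frac_rank_exact (@BE n); rewrite PoszD => rkE.
  rewrite big_ord_recr /= IHn [X in _ + _ * X = _]rkE mulrDr exprS.
  by rewrite !mulN1r !mulNr addrA addrK.
have rB : \rank (frac_mx (B L)) = 0%N.
  by apply/eqP; rewrite -leqn0 -[X in (_ <= X)%N](rk0 (leqnSn L)) rank_leq_row.
have := H L; rewrite rB big_ord_recr /= [X in _ + _ * Posz X]rk0 //.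
by rewrite !mulr0 !addr0.
Qed.

End FractionRank.

(** * The polynomial action on a Hilbert module *)

Section ModuleAction.
Variables (R : realType) (d : nat) (H : hilbertModule R d).
Local Notation C := R[i].
Local Notation A := (mpoly d C).
Local Notation T := (@hop R d H).

Lemma iter_hopD k i x y : iter k (T i) (x + y) = iter k (T i) x + iter k (T i) y.
Proof. by elim: k => //= k ->; rewrite linearD. Qed.

Lemma iter_hopZ k i c x : iter k (T i) (c *: x) = c *: iter k (T i) x.
Proof. by elim: k => //= k ->; rewrite linearZ. Qed.

Lemma iter_hopC k l i j x :
  iter k (T i) (iter l (T j) x) = iter l (T j) (iter k (T i) x).
Proof.
have hopC y : T i (iter l (T j) y) = iter l (T j) (T i y).
  by elim: l => //= l <-; rewrite hop_comm.
by elim: k => //= k ->.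
Qed.

Lemma monomial_actD m x y :
  @monomial_act R d H m (x + y) = monomial_act m x + monomial_act m y.
Proof. by rewrite /monomial_act; elim: (enum _) => //= i s ->; rewrite iter_hopD. Qed.

Lemma monomial_actZ m c x : @monomial_act R d H m (c *: x) = c *: monomial_act m x.
Proof. by rewrite /monomial_act; elim: (enum _) => //= i s ->; rewrite iter_hopZ. Qed.

Lemma monomial_actM m1 m2 x :
  @monomial_act R d H (mnm_add m1 m2) x = monomial_act m1 (monomial_act m2 x).
Proof.
rewrite /monomial_act; elim: (enum _) => //= i s ->.
rewrite mnmDE iterD; congr (iter _ _ _).
elim: s (foldr _ x s) => //= j s IHs y.
by rewrite iter_hopC IHs.
Qed.

Lemma monomial_act0 x : @monomial_act R d H mnm0 x = x.
Proof. by rewrite /monomial_act; elim: (enum _) => //= i s ->; rewrite mnm0E. Qed.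

Lemma monomial_act1 i x : @monomial_act R d H (mnm1 i) x = T i x.
Proof.
rewrite /monomial_act; have : i \in enum 'I_d by rewrite mem_enum.
have : uniq (enum 'I_d) by exact: enum_uniq.
elim: (enum _) => //= j s IHs /andP[js us]; rewrite inE mnm1E.
have [ij _|ij /= is_] := eqVneq i j; last exact: IHs.
rewrite -ij in js *; congr (T i _).
elim: s js {IHs us} => //= k s IHs; rewrite inE negb_or => /andP[/negPf ik /IHs ->].
by rewrite mnm1E ik.
Qed.

(** Summing over one fixed finite set of monomials, instead of the support of f, makes additivity in
    f visible. *)
Lemma actE k (f : A) (x : H) : (msize f <= k)%N ->
  act f x = \sum_(m : bmultinom d k) mcoeff m f *: monomial_act m x.
Proof.
move=> fk; pose I : subFinType _ := bmultinom d k.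
rewrite /act (ssrcomplements.big_mksub I) ?msupp_uniq //=; last first.
  by move=> m /msize_mdeg_lt /leq_trans; apply.
by rewrite big_rmcond //= => j /memN_msupp_eq0 ->; rewrite scale0r.
Qed.

Lemma actDl (f g : A) (x : H) : act (f + g) x = act f x + act g x.
Proof.
pose k := maxn (msize (f + g)) (maxn (msize f) (msize g)).
rewrite !(@actE k) ?leq_max ?leqnn ?orbT // -big_split.
by apply: eq_bigr => m _; rewrite mcoeffD scalerDl.
Qed.

Lemma actDr (f : A) (x y : H) : act f (x + y) = act f x + act f y.
Proof.
by rewrite /act -big_split; apply: eq_bigr => m _; rewrite monomial_actD scalerDr.
Qed.

Lemma actZl c (f : A) (x : H) : act (c *: f) x = c *: act f x.
Proof.
rewrite !(@actE (msize f)) ?msizeZ_le // scaler_sumr.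
by apply: eq_bigr => m _; rewrite mcoeffZ scalerA.
Qed.

Lemma actX m (x : H) : act (mpolyX C m : A) x = monomial_act m x.
Proof. by rewrite /act msuppX big_seq1 mcoeffX eqxx scale1r. Qed.

Lemma act0l (x : H) : act (0 : A) x = 0.
Proof. by apply: (addIr (act (0 : A) x)); rewrite -actDl !add0r. Qed.

Lemma is_action_act : is_action (@act R d H).
Proof.
split; [exact: actDl|exact: actDr| |]; last first.
  by move=> x; rewrite -mpolyX0 actX monomial_act0.
have actXM m (g : A) (x : H) : act (mpolyX C m * g) x = monomial_act m (act g x).
  elim/mpolyind: g => [|c n g _ _ IHg].
    rewrite mulr0 act0l -(scale0r (0 : H)) monomial_actZ.
    by rewrite !scale0r.
  rewrite mulrDr !actDl monomial_actD IHg -scalerAr -mpolyXD !actZl !actX.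
  by rewrite monomial_actZ monomial_actM.
move=> f g x; elim/mpolyind: f => [|c n f _ _ IHf]; first by rewrite mul0r !act0l.
by rewrite mulrDl !actDl IHf -scalerAl !actZl actXM actX.
Qed.

Lemma actC c (x : H) : act (mpolyC d c : A) x = c *: x.
Proof. by rewrite -[mpolyC d c]mulr1 mul_mpolyC actZl (action1 is_action_act). Qed.

Lemma free_resolution_exists q (F : 'I_q -> H) n :
  @defect_submodule R d H = range (comb (@act R d H) F) ->
  ffr n [set v | comb (@act R d H) F v = 0] -> inhabited (free_resolution H).
Proof.
move=> FE /ffr_unroll [r [r0 [M [kF ME]]]].
split; apply: (@FreeResolution _ _ _ n.+1 _ r0 (fun k => mulmxr (M k))
  (comb (@act R d H) F)) => //.
- exact: (combD is_action_act).
- exact: (combZ is_action_act).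
- move=> v; have -> : (comb (@act R d H) F v = 0) = range (mulmx^~ (M 0%N)) v by rewrite -kF.
  by split=> [[w _ wv]|[w wv]]; exists w.
Qed.

(** All resolutions give the same value m, and the syzygy theorem provides one, so the selection in
    [euler_char] does not fall back on its default 0. *)
Lemma euler_char_eq (m r : nat) (g : 'I_r -> H) (e : 'I_m -> H) :
  @defect_submodule R d H = range (comb (@act R d H) g) ->
  (forall i, range (comb (@act R d H) g) (e i)) ->
  (forall v, comb (@act R d H) e v = 0 -> v = 0) ->
  (forall x, range (comb (@act R d H) g) x ->
    exists f w, f != 0 /\ act f x = comb (@act R d H) e w) ->
  euler_char H = m%:Z.
Proof.
move=> gE eg e_free e_max.
have charE (F : free_resolution H) : resolution_char F = m%:Z.
  pose M k := lin1_mx (fr_map F k).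
  have ME k v : fr_map F k v = v *m M k by rewrite mul_rV_lin1.
  apply: (@euler_sum _ _ _ M (@fr_rank0 _ _ _ F) _ _ _ (@fr_aug _ _ _ F) is_action_act
    (@fr_augD _ _ _ F) (@fr_augZ _ _ _ F) _ _ e) => //.
  - by move=> k v; rewrite -ME fr_exact; split=> -[w wv]; exists w; rewrite -wv ME.
  - by move=> v; rewrite fr_exact0; split=> -[w wv]; exists w; rewrite -wv ME.
  - by move=> i; rewrite fr_aug_range gE.
  - by move=> v; apply: e_max; rewrite -gE -(fr_aug_range F); exists v.
have [_ resA] := acc_resolvable_mpoly C d.
have [|q [F [gF [n kF]]]] := resA _ _ is_action_act (range (comb (@act R d H) g)).
  by exists r, g.
rewrite gF in gE; have [F0] := free_resolution_exists gE kF.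
by rewrite /euler_char; case: xgetP => [c _ [F1 ->]//|/(_ m%:Z)[]]; exists F0.
Qed.

End ModuleAction.

(** * Dimension of the filtration *)

Section Dimensions.
Variables (K : fieldType) (V : lmodType K).

Lemma is_action_scale : is_action (fun (c : K) (v : V) => c *: v).
Proof.
split=> *; [exact: scalerDl|exact: scalerDr|by rewrite scalerA|exact: scale1r].
Qed.
Local Notation lcomb := (comb (fun (c : K) (v : V) => c *: v)).
Let sA := is_action_scale.

(** Indexed by any finite type, since the spanning families to come are indexed by pairs of a
    generator and a monomial. *)
Definition span (I : finType) (b : I -> V) : set V :=
  range (fun a : I -> K => \sum_i a i *: b i).

Lemma span_comb n (b : 'I_n -> V) : span b = range (lcomb b).
Proof.
apply/seteqP; split=> x [a _ <-].
  by exists (\row_i a i) => //; apply: eq_bigr => i _; rewrite mxE.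
by exists (fun i => a 0 i).
Qed.

Lemma sum_enum_val (I : finType) (F : I -> V) :
  \sum_i F i = \sum_(k < #|I|) F (enum_val k).
Proof. by rewrite (reindex _ (onW_bij _ (enum_val_bij I))). Qed.

Lemma span_enum_val (I : finType) (b : I -> V) :
  span b = span (fun k : 'I_#|I| => b (enum_val k)).
Proof.
apply/seteqP; split=> x [a _ <-].
  by exists (fun k => a (enum_val k)); rewrite // [RHS]sum_enum_val.
exists (fun i => a (enum_rank i)) => //; rewrite sum_enum_val.
by apply: eq_bigr => k _; rewrite enum_valK.
Qed.

Definition indep (I : finType) (b : I -> V) : Prop :=
  forall a : I -> K, \sum_i a i *: b i = 0 -> forall i, a i = 0.

Lemma indep_le_dim (S : set V) n (J : finType) (c : J -> V) :
  has_dim S n -> (forall j, S (c j)) -> indep c -> (#|J| <= n)%N.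
Proof.
move=> [b [_ ->]] cS c_free.
have /choice[M' MP] (j : 'I_#|J|) : exists a : 'rV_n, c (enum_val j) = lcomb b a.
  have := cS (enum_val j); rewrite -/(span b) span_comb => -[a _ <-].
  by exists a.
pose M := \matrix_j M' j.
suff : row_free M by move=> /eqP <-; exact: rank_leq_col.
rewrite -kermx_eq0; apply/eqP/row_matrixP => i; rewrite row0.
have : row i (kermx M) *m M = 0 by rewrite -row_mul mulmx_ker row0.
move: (row i _) => u uM; apply/rowP => j; rewrite mxE -[j]enum_valK.
apply: (c_free (fun j => u 0 (enum_rank j))); rewrite sum_enum_val.
have := comb_mulmx sA b M u; rewrite uM (comb0 sA) => /esym; apply: etrans.
by apply: eq_bigr => k _; rewrite rowK MP enum_valK.
Qed.

Lemma has_dim_unique (S : set V) m n : has_dim S m -> has_dim S n -> m = n.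
Proof.
move=> Sm Sn; apply/eqP; rewrite eqn_leq.
have [bm [bm_free Sbm]] := Sm; have [bn [bn_free Sbn]] := Sn.
have mem k (b : 'I_k -> V) i : span b (b i).
  by rewrite span_comb; exists (delta_mx 0 i); rewrite // (comb_delta sA).
rewrite -[X in (X <= n)%N]card_ord -[X in (X <= m)%N]card_ord; apply/andP; split.
  by apply: (indep_le_dim Sn) bm_free => j; rewrite Sbm; exact: mem.
by apply: (indep_le_dim Sm) bn_free => j; rewrite Sbn; exact: mem.
Qed.

Lemma set_dim_eq (S : set V) n : has_dim S n -> set_dim S = n.
Proof.
move=> Sn; rewrite /set_dim; case: xgetP => [m _ Sm|/(_ n)/=//].
exact: has_dim_unique Sn.
Qed.

(** A complement of the space of all relations among the b maps isomorphically onto their span, and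
    the rows of Q bound the dimension of the space of relations from below. With J empty, this only
    provides a dimension for the span. *)
Lemma span_dim (I J : finType) (b : I -> V) (Q : J -> I -> K) :
  (forall j, \sum_i Q j i *: b i = 0) ->
  (forall u : J -> K, (forall i, \sum_j u j * Q j i = 0) -> forall j, u j = 0) ->
  exists D, has_dim (span b) D /\ (D + #|J| <= #|I|)%N.
Proof.
move=> Qb Qfree; rewrite span_enum_val span_comb.
pose b' (k : 'I_#|I|) := b (enum_val k); rewrite -/b'.
have [s [B [Bfree kB]]] := submodule_rowspan (comb_ker_submodule b' sA).
have kerP v : lcomb b' v = 0 <-> (v <= B)%MS.
  split=> [v0|/submxP[u ->]].
    by have : [set v | lcomb b' v = 0] v by []; rewrite kB => -[u _ <-]; exact: submxMl.
  by have : [set v | lcomb b' v = 0] (u *m B) by rewrite kB; exists u.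
pose Bc := row_base (B^C)%MS.
exists (\rank (B^C)%MS); split.
  exists (fun i => lcomb b' (row i Bc)); split.
    move=> a; pose u := \row_i a i => a0; suff : u = 0.
      by move=> /rowP u0 i; have := u0 i; rewrite !mxE.
    have : (u *m Bc <= B :&: B^C)%MS.
      rewrite sub_capmx; apply/andP; split; last first.
        by rewrite -(eq_row_base (B^C)%MS) submxMl.
      apply/kerP; rewrite (comb_mulmx sA) -[RHS]a0.
      by apply: eq_bigr => i _; rewrite mxE.
    rewrite capmx_compl submx0 => /eqP uBc.
    by apply: (row_free_inj (row_base_free (B^C)%MS)); rewrite /= uBc mul0mx.
  rewrite -/(span _) span_comb; apply/seteqP; split=> x [v _ <-]; last first.
    by exists (v *m Bc) => //; rewrite (comb_mulmx sA).
  have : (v <= B + B^C)%MS by apply: submx_trans (submx1 _) _; rewrite sub1mx addsmx_compl_full.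
  move=> /sub_addsmxP[[u1 u2] /= ->].
  have : (u2 *m (B^C)%MS <= Bc)%MS by rewrite eq_row_base submxMl.
  move=> /submxP[w wE]; exists w => //; rewrite (combD sA) wE.
  have /kerP -> : (u1 *m B <= B)%MS by exact: submxMl.
  by rewrite add0r (comb_mulmx sA).
rewrite mxrank_compl.
pose M := \matrix_(j < #|J|, i < #|I|) Q (enum_val j) (enum_val i).
have Mfree : row_free M.
  rewrite -kermx_eq0; apply/eqP/row_matrixP => i; rewrite row0.
  have : row i (kermx M) *m M = 0 by rewrite -row_mul mulmx_ker row0.
  move: (row i _) => u uM; apply/rowP => j; rewrite mxE -[j]enum_valK.
  apply: (Qfree (fun j => u 0 (enum_rank j))) => k.
  have /rowP/(_ (enum_rank k)) := uM; rewrite !mxE => /esym kE.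
  rewrite [RHS]kE (reindex _ (onW_bij _ (enum_val_bij J))).
  by apply: eq_bigr => l _; rewrite mxE enum_valK enum_rankK.
have MB : (M <= B)%MS.
  apply/row_subP => j; apply/kerP; rewrite -[RHS](Qb (enum_val j)) sum_enum_val.
  by apply: eq_bigr => k _; rewrite !mxE.
have := mxrankS MB; rewrite (eqP Mfree) => JB.
by apply: leq_trans (leq_add (leqnn _) JB) _; rewrite subnK ?rank_leq_col.
Qed.

End Dimensions.

(** * A maximal independent subfamily of the generators *)

Section MaximalFreeSubfamily.
Variables (A : idomainType) (V : zmodType) (a : A -> V -> V).
Hypothesis aA : is_action a.
Variables (r : nat) (g : 'I_r -> V).

(** Subfamilies are handled through coefficient vectors of full length r, which avoids reindexing
    when J grows. *)
Definition supported (J : {set 'I_r}) (v : 'rV[A]_r) : Prop :=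
  forall j, j \notin J -> v 0 j = 0.

Definition free_on (J : {set 'I_r}) : Prop :=
  forall v, supported J v -> comb a g v = 0 -> v = 0.

(** J is taken of maximal cardinality. Adding j creates a relation, whose coefficient at j is
    nonzero since J itself is free. *)
Lemma max_free_subfamily : exists (J : {set 'I_r}) (rel : 'I_r -> 'rV[A]_r),
  free_on J /\ forall j, j \notin J ->
    [/\ comb a g (rel j) = 0, rel j 0 j != 0 & supported (j |: J) (rel j)].
Proof.
have free0 : free_on finset.set0.
  by move=> v v0 _; apply/rowP => j; rewrite mxE v0 // inE.
pose P (J : {set 'I_r}) := `[< free_on J >].
have P0 : P finset.set0 by apply/asboolP.
case: (arg_maxnP (fun J : {set 'I_r} => #|J|) P0) => J /asboolP Jfree Jmax.
have relP j : exists v : 'rV[A]_r, j \notin J ->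
    [/\ comb a g v = 0, v 0 j != 0 & supported (j |: J) v].
  have [jJ|jJ] := boolP (j \in J); first by exists 0.
  have : ~ free_on (j |: J).
    move=> /asboolP/Jmax; rewrite cardsU1 jJ => /=.
    by rewrite /= add1n ltnn.
  move=> /existsNP[v /not_implyP[vJ /not_implyP[v0 vN0]]].
  exists v => _; split=> //; apply/eqP => vj0; apply: vN0; apply: Jfree => // i iJ.
  by have [->//|ij] := eqVneq i j; apply: vJ; rewrite !inE negb_or ij.
by have /choice[rel] := relP => relE; exists J, rel.
Qed.

Variables (J : {set 'I_r}) (rel : 'I_r -> 'rV[A]_r).
Hypothesis Jfree : free_on J.
Hypothesis relP : forall j, j \notin J ->
  [/\ comb a g (rel j) = 0, rel j 0 j != 0 & supported (j |: J) (rel j)].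
Let e (i : 'I_#|J|) := g (enum_val i).

Lemma comb_supported v : supported J v ->
  comb a g v = comb a e (\row_i v 0 (enum_val i)).
Proof.
move=> vJ; rewrite /comb (bigID (mem J)) /= addrC big1 ?add0r; last first.
  by move=> i iJ; rewrite vJ // (action0l aA).
rewrite big_enum_val /=.
by apply: eq_bigr => i _; rewrite mxE.
Qed.

Lemma comb_sub_free v : comb a e v = 0 -> v = 0.
Proof.
move=> v0; pose M : 'M[A]_(#|J|, r) := \matrix_i delta_mx 0 (enum_val i).
have vM i : (v *m M) 0 (enum_val i) = v 0 i.
  rewrite mxE (bigD1 i) //= !mxE !eqxx mulr1 big1 ?addr0 // => k ki.
  by rewrite !mxE (inj_eq enum_val_inj) eq_sym (negPf ki) mulr0.
have : v *m M = 0.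
  apply: Jfree => [j jJ|].
    rewrite mxE big1 // => i _; rewrite !mxE /=.
    by case: eqP jJ => [->|]; rewrite ?enum_valP ?mulr0.
  rewrite (comb_mulmx aA) -[RHS]v0; apply: eq_bigr => i _.
  by rewrite rowK (comb_delta aA).
by move=> vM0; apply/rowP => i; rewrite -vM vM0 !mxE.
Qed.

Lemma comb_sub_max x : range (comb a g) x ->
  exists f w, f != 0 /\ a f x = comb a e w.
Proof.
move=> [w _ <-].
have /choice[f /choice[u fuP]] j : exists f (u : 'rV_#|J|),
    f != 0 /\ a f (g j) = comb a e u.
  have [jJ|jJ] := boolP (j \in J).
    exists 1, (delta_mx 0 (enum_rank_in jJ j)); rewrite oner_neq0; split=> //.
    by rewrite (comb_delta aA) (action1 aA) /e enum_rankK_in.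
  have [rel0 relj relJ] := relP jJ; exists (rel j 0 j).
  pose v : 'rV[A]_r := rel j 0 j *: delta_mx 0 j - rel j.
  exists (\row_i v 0 (enum_val i)); split=> //; rewrite -comb_supported.
    by rewrite (combB aA) rel0 subr0 (combZ aA) (comb_delta aA).
  move=> i iJ; rewrite !mxE eqxx /=; have [->|ij] := eqVneq i j.
    by rewrite mulr1 subrr.
  by rewrite mulr0 sub0r relJ ?oppr0 // !inE negb_or ij.
(* The product of all f_j is a multiple of each, so it brings every term of the combination into the
   span of e. *)
exists (\prod_j f j), (\sum_j (w 0 j * \prod_(k | k != j) f k) *: u j); split.
  by apply/prodf_neq0 => j _; case: (fuP j).
rewrite (action_sumr aA) (comb_sum aA); apply: eq_bigr => j _.
rewrite (combZ aA); case: (fuP j) => _ <-.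
by rewrite -!(actionM aA) (bigD1 j) //= mulrC mulrCA mulrC -!mulrA.
Qed.

End MaximalFreeSubfamily.

Lemma sum_pair (I J : finType) (V : nmodType) (F : I * J -> V) :
  \sum_p F p = \sum_i \sum_j F (i, j).
Proof. by rewrite pair_bigA; apply: eq_bigr => -[]. Qed.

(** * Polynomials of bounded degree and their coefficient families *)

Section BoundedDegree.
Variables (K : nzRingType) (d k : nat).

Definition mpoly_of_coefs (u : bmultinom d k -> K) : mpoly d K :=
  \sum_(m : bmultinom d k) u m *: mpolyX K m.

Lemma mcoeff_mpoly_of_coefs u (m : bmultinom d k) : mcoeff m (mpoly_of_coefs u) = u m.
Proof.
rewrite /mpoly_of_coefs raddf_sum /= (bigD1 m) //= mcoeffZ mcoeffX eqxx mulr1.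
rewrite big1 ?addr0 // => n nm; rewrite mcoeffZ mcoeffX.
by rewrite (_ : _ == _ = false) ?mulr0 //; apply/negP => /eqP/val_inj nE; rewrite nE eqxx in nm.
Qed.

Lemma msize_mpoly_of_coefs u : (msize (mpoly_of_coefs u) <= k)%N.
Proof.
rewrite /mpoly_of_coefs; apply: (leq_trans (msize_sum _ _ _)).
apply/bigmax_leqP => m _; apply: (leq_trans (msizeZ_le _ _)).
by rewrite msizeX bmdeg.
Qed.

Lemma mpoly_of_coefs_eq0 u : mpoly_of_coefs u = 0 -> forall m, u m = 0.
Proof. by move=> u0 m; rewrite -mcoeff_mpoly_of_coefs u0 mcoeff0. Qed.

End BoundedDegree.

(** * Lower and upper bounds for the dimension of the filtration *)

Section HilbertFunction.
Variables (R : realType) (d : nat) (H : hilbertModule R d).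
Local Notation C := R[i].
Local Notation A := (mpoly d C).
Variables (r : nat) (g : 'I_r -> H).
Variables (J : {set 'I_r}) (rel : 'I_r -> 'rV[A]_r).
Local Notation comb_act := (comb (@act R d H)).
Hypothesis Jfree : free_on (@act R d H) g J.
Hypothesis relP : forall j, j \notin J ->
  [/\ comb_act g (rel j) = 0, rel j 0 j != 0 & supported (j |: J) (rel j)].

(* The elements f_1 g_1 + ... + f_r g_r with the f_i of degree at most n. *)
Definition filtered_part (n : nat) : set H :=
  span (fun p : 'I_r * bmultinom d n.+1 => monomial_act p.2 (g p.1)).

Lemma act_mpoly_of_coefs k (u : bmultinom d k -> C) (x : H) :
  act (mpoly_of_coefs u) x = \sum_m u m *: monomial_act m x.
Proof.
rewrite (actE _ (msize_mpoly_of_coefs u)).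
by apply: eq_bigr => m _; rewrite mcoeff_mpoly_of_coefs.
Qed.

Lemma sum_act_coefs q (e : 'I_q -> H) k (u : 'I_q * bmultinom d k -> C) :
  \sum_p u p *: monomial_act p.2 (e p.1) =
  comb_act e (\row_i mpoly_of_coefs (fun m => u (i, m))).
Proof.
by rewrite sum_pair; apply: eq_bigr => i _; rewrite mxE act_mpoly_of_coefs.
Qed.

Let e (i : 'I_#|J|) := g (enum_val i).

(** The vectors x^m e_i with x^m of degree at most n are independent over the scalars because the
    e_i are independent over A. *)
Lemma filtered_part_dim_ge n D : has_dim (filtered_part n) D ->
  (#|J| * #|{: bmultinom d n.+1}| <= D)%N.
Proof.
move=> nD; rewrite -[X in (X * _)%N]card_ord -card_prod.
apply: (@indep_le_dim _ H _ _ ('I_#|J| * bmultinom d n.+1)%type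
  (fun p => monomial_act p.2 (e p.1)) nD) => [p|u].
  exists (fun q => (q == (enum_val p.1, p.2))%:R) => //.
  rewrite (bigD1 (enum_val p.1, p.2)) //= eqxx scale1r big1 ?addr0 // => q.
  by move=> /negPf ->; rewrite scale0r.
rewrite sum_act_coefs => /(comb_sub_free (is_action_act H) Jfree) u0 [i m].
have /rowP/(_ i) := u0; rewrite !mxE => /mpoly_of_coefs_eq0; exact.
Qed.

(** For x^m of degree at most n - c, each x^m rel_j is a linear relation among the spanning vectors
    of M_n, so [span_dim] applies. *)
Lemma filtered_part_dim_le : exists c, forall n, (c <= n)%N ->
  exists D, has_dim (filtered_part n) D /\
    (D + (r - #|J|) * #|{: bmultinom d (n - c).+1}| <= r * #|{: bmultinom d n.+1}|)%N.
Proof.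
(* c exceeds the degree of every nonzero entry of every relation. *)
pose c := (\max_j \max_i msize (rel j 0%R i))%N.
have relc j i : (msize (rel j 0%R i) <= c)%N.
  apply: leq_trans (leq_bigmax j); exact: leq_trans (leq_bigmax i).
exists c => n cn.
have size_prod k m (p : A) : (c <= k)%N -> (mdeg m <= k - c)%N -> (msize p <= c)%N ->
    (msize (mpolyX C m * p) <= k.+1)%N.
  move=> ck mk pc; have [->|p0] := eqVneq p 0; first by rewrite mulr0 msize0.
  have Xm : mpolyX C m != 0 by rewrite -msize_poly_eq0 msizeX.
  rewrite msizeM // msizeX addSn /= ltnW // ltnS.
  by rewrite -(subnK ck) leq_add.
have [|u u0|D [nD Dle]] := @span_dim _ H ('I_r * bmultinom d n.+1)%type
    ('I_#|~: J| * bmultinom d (n - c).+1)%type (fun p => monomial_act p.2 (g p.1))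
    (fun q p => mcoeff p.2 (mpolyX C q.2 * rel (enum_val q.1) 0 p.1)).
- move=> [j m] /=.
  have jJ : enum_val j \notin J by have := enum_valP j; rewrite inE.
  rewrite sum_pair /=.
  have [rel0 _ _] := relP jJ.
  transitivity (act (mpolyX C m) (comb_act g (rel (enum_val j)))); last first.
    by rewrite rel0 (action0r (is_action_act H)).
  rewrite (action_sumr (is_action_act H)); apply: eq_bigr => i _.
  rewrite -(actionM (is_action_act H)) (@actE _ _ _ n.+1) //.
  by apply: size_prod => //; rewrite -ltnS bmdeg.
- move=> [j m]; pose P i := mpoly_of_coefs (fun m => u (i, m)).
  have jJ : enum_val j \notin J by have := enum_valP j; rewrite inE.
  have [_ relj _] := relP jJ.
  (* Among the relations used, only rel_j has a nonzero entry at j, which lies outside J; comparing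
     coefficients there isolates P j. *)
  suff /eqP : P j * rel (enum_val j) 0 (enum_val j) = 0.
    by rewrite mulf_eq0 (negPf relj) orbF => /eqP/mpoly_of_coefs_eq0.
  have Pn : (msize (P j * rel (enum_val j) 0%R (enum_val j))%R <= n.+1)%N.
    rewrite /P /mpoly_of_coefs mulr_suml; apply: (leq_trans (msize_sum _ _ _)).
    apply/bigmax_leqP => l _; rewrite -scalerAl; apply: (leq_trans (msizeZ_le _ _)).
    by apply: size_prod => //; rewrite -ltnS bmdeg.
  rewrite [LHS](mpolywE Pn) big1 // => l _; rewrite (_ : mcoeff _ _ = 0) ?scale0r //.
  rewrite -[RHS](u0 (enum_val j, l)) /=.
  rewrite sum_pair /=.
  rewrite (bigD1 j) //= [X in _ + X]big1 ?addr0 => [|i ij]; last first.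
    have iJ : enum_val i \notin J by have := enum_valP i; rewrite inE.
    have [_ _ reli] := relP iJ; apply: big1 => m' _.
    rewrite reli ?mulr0 ?mcoeff0 ?mulr0 // !inE negb_or jJ andbT.
    by rewrite (inj_eq enum_val_inj) eq_sym.
  rewrite /P /mpoly_of_coefs mulr_suml raddf_sum; apply: eq_bigr => m' _.
  by rewrite -scalerAl /= mcoeffZ.
- exists D; split=> //; move: Dle; rewrite !card_prod !card_ord.
  by rewrite -[X in (_ + (X - _) * _)%N]card_ord -(cardsC J) addKn.
Qed.

End HilbertFunction.

Lemma card_bmultinom d n : #|{: bmultinom d n.+1}| = 'C(d + n, d).
Proof.
rewrite -card_partial_ord_partitions -cardsT.
pose f (m : bmultinom d n.+1) : d.-tuple 'I_n.+1 := [tuple inord (m i) | i < d].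
have mle (m : bmultinom d n.+1) i : (m i < n.+1)%N.
  by apply: leq_trans (bmdeg m); rewrite ltnS mdegE (bigD1 i) //= leq_addr.
have finj : injective f.
  move=> m1 m2 f12; apply/val_inj/mnmP => i /=.
  have := congr1 (fun t => val (tnth t i)) f12.
  by rewrite /= !tnth_mktuple !inordK.
rewrite -(card_imset _ finj); apply: eq_card => t; rewrite inE.
apply/imsetP/idP => [[m _ ->]|tn].
  rewrite big_tuple -ltnS; apply: leq_trans (bmdeg m); rewrite ltnS mdegE.
  by apply: leq_sum => i _; rewrite tnth_mktuple inordK.
have mP : (mdeg (Multinom [tuple val (tnth t i) | i < d]) < n.+1)%N.
  rewrite ltnS mdegE; apply: leq_trans tn; rewrite big_tuple.
  by apply: leq_sum => i _; rewrite mnmE.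
exists (BMultinom mP) => //; apply: eq_from_tnth => i.
by rewrite tnth_mktuple /= mnmE inord_val.
Qed.

(** * Asymptotics of binomial coefficients *)

Section BinomialLimit.
Variable R : realType.

Lemma cvg_natr_shift k c : (fun n => (n + k)%:R / (n + c.+1)%:R : R) @ \oo --> (1 : R).
Proof.
have inv0 : (fun n => (n + c.+1)%:R^-1 : R) @ \oo --> (0 : R).
  have := @cvg_harmonic R; rewrite -(cvg_shiftn c); apply: cvg_trans.
  by apply: near_eq_cvg; near=> n; rewrite addnS.
have -> : (fun n => (n + k)%:R / (n + c.+1)%:R : R) =
    (fun n => 1 + (k%:R - c.+1%:R) * (n + c.+1)%:R^-1).
  apply/funext => n; have n0 : (n + c.+1)%:R != 0 :> R by rewrite pnatr_eq0 addnS.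
  apply: (mulIf n0); rewrite mulrDl mul1r -!mulrA mulVf // !mulr1 !natrD.
  by rewrite [k%:R - _]addrC addrA addrK.
have := cvgD (cvg_cst (1 : R)) (cvgM (cvg_cst (k%:R - c.+1%:R : R)) inv0).
by rewrite mulr0 addr0; exact.
Unshelve. all: by end_near.
Qed.

Lemma cvg_prod_1 (F : nat -> nat -> R) (s : seq nat) :
  (forall i, F i @ \oo --> (1 : R)) ->
  (fun n => \prod_(i <- s) F i n) @ \oo --> (1 : R).
Proof.
move=> F1; elim: s => [|i s IHs].
  by under eq_fun do rewrite big_nil; exact: cvg_cst.
under eq_fun do rewrite big_cons.
by have := cvgM (F1 i) IHs; rewrite mulr1; exact.
Qed.

Lemma cvg_binomial d c :
  (fun n => 'C(d + (n - c), d)%:R / (n ^ d)%:R : R) @ \oo --> ((d`!%:R)^-1 : R).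
Proof.
(* The shift by c + 1 removes the truncated subtraction and keeps the denominators nonzero; what
   remains is 1 / d! times d quotients tending to 1. *)
rewrite -(cvg_shiftn c.+1).
have -> : (fun n => 'C(d + (n + c.+1 - c), d)%:R / ((n + c.+1) ^ d)%:R : R) =
    (fun n => d`!%:R^-1 * \prod_(i <- iota 0 d) ((n + (d.+1 - i))%:R / (n + c.+1)%:R)).
  apply/funext => n; rewrite addnS subSn ?leq_addl // addnK.
  have fd : d`!%:R != 0 :> R by rewrite pnatr_eq0 -lt0n fact_gt0.
  apply: (mulfI fd); rewrite mulVKf // mulrA -natrM mulnC bin_ffact ffact_prod.
  have -> : iota 0 d = index_iota 0 d by rewrite /index_iota subn0.
  rewrite big_mkord prodf_div natr_prod natrX.
  rewrite prodr_const card_ord; congr (_ / _); apply: eq_bigr => i _.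
  by rewrite addnS -addSn addnC -addnBA // ltnW // ltnS ltnW.
have := @cvg_prod_1 (fun i n => (n + (d.+1 - i))%:R / (n + c.+1)%:R) (iota 0 d)
  (fun i => cvg_natr_shift _ _).
by move=> /(cvgM (cvg_cst (d`!%:R^-1 : R))); rewrite mulr1; exact.
Qed.

(** The shift by c does not affect the leading term, so the upper bound tends to r / d! - (r - m) /
    d!, the limit of the lower bound. *)
Lemma cvg_sandwich d m r c (D : nat -> nat) : (m <= r)%N ->
  (forall n, (m * 'C(d + n, d) <= D n)%N) ->
  (forall n, (c <= n)%N ->
    (D n + (r - m) * 'C(d + (n - c), d) <= r * 'C(d + n, d))%N) ->
  (fun n => (D n)%:R / (n ^ d)%:R : R) @ \oo --> (m%:R / d`!%:R : R).
Proof.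
move=> mr Dge Dle.
pose N c n : R := 'C(d + (n - c), d)%:R / (n ^ d)%:R.
have Nc c' : N c' @ \oo --> ((d`!%:R)^-1 : R) by exact: cvg_binomial.
apply: (@squeeze_cvgr _ _ _ _ (fun n => m%:R * N 0%N n)
  (fun n => r%:R * N 0%N n - (r - m)%:R * N c n)).
- near=> n; have cn : (c <= n)%N by near: n; exact: nbhs_infty_ge.
  rewrite /N subn0 !mulrA -mulrBl !ler_wpM2r ?invr_ge0 ?ler0n //=.
    by rewrite lerBrDr -!natrM -natrD ler_nat Dle.
  by rewrite -natrM ler_nat.
- by apply: cvgM => //; exact: cvg_cst.
- have -> : m%:R / d`!%:R = r%:R * d`!%:R^-1 - (r - m)%:R * d`!%:R^-1 :> R.
    by rewrite -mulrBl natrB // opprB addrCA subrr addr0.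
  by apply: cvgB; apply: cvgM => //; exact: cvg_cst.
Unshelve. all: by end_near.
Qed.
End BinomialLimit.

(** * Hilbert space operators *)

Section HilbertGeometry.
Variables (R : realType) (H : hilbertSpace R).
Local Open Scope complex_scope.

Definition nrm (x : H) : R := complex.Re `|x|.
(** The underlying real inner product: estimates and minimisation then take place in R, and
    [hdot_of_rdot] recovers complex identities. *)
Definition rdot (x y : H) : R := complex.Re (hdot H x y).
Definition rscale (r : R) (x : H) : H := r%:C *: x.

Lemma nrmE x : `|x| = (nrm x)%:C.
Proof. by rewrite /nrm RRe_real // ger0_real. Qed.

Lemma hdotDl x y z : hdot H (x + y) z = hdot H x z + hdot H y z.
Proof. by rewrite linearDl. Qed.

Lemma hdotDr x y z : hdot H z (x + y) = hdot H z x + hdot H z y.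
Proof. by rewrite linearDr. Qed.

Lemma hdotZl c x z : hdot H (c *: x) z = c * hdot H x z.
Proof. by rewrite linearZl. Qed.

Lemma hdotZr c x z : hdot H z (c *: x) = c^* * hdot H z x.
Proof. by rewrite linearZr. Qed.

Lemma hdotC x z : hdot H x z = (hdot H z x)^*.
Proof. by rewrite hermC expr0 mul1r. Qed.

Lemma rdotC x y : rdot x y = rdot y x.
Proof. by rewrite /rdot hdotC; case: (hdot H y x). Qed.

Lemma rdotDl x y z : rdot (x + y) z = rdot x z + rdot y z.
Proof. by rewrite /rdot hdotDl; case: (hdot H x z); case: (hdot H y z). Qed.

Lemma rdotDr x y z : rdot z (x + y) = rdot z x + rdot z y.
Proof. by rewrite rdotC rdotDl !(rdotC z). Qed.

Lemma rdotZl r x y : rdot (rscale r x) y = r * rdot x y.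
Proof.
by rewrite /rdot hdotZl; case: (hdot H x y) => a b /=; rewrite mul0r subr0.
Qed.

Lemma rdotZr r x y : rdot x (rscale r y) = r * rdot x y.
Proof. by rewrite rdotC rdotZl rdotC. Qed.

Lemma rscaleN1 x : rscale (- 1) x = - x.
Proof. by rewrite /rscale rmorphN1 scaleN1r. Qed.

Lemma rdotNl x y : rdot (- x) y = - rdot x y.
Proof. by rewrite -rscaleN1 rdotZl mulN1r. Qed.

Lemma rdotNr x y : rdot x (- y) = - rdot x y.
Proof. by rewrite rdotC rdotNl rdotC. Qed.

Lemma rdotBl x y z : rdot (x - y) z = rdot x z - rdot y z.
Proof. by rewrite rdotDl rdotNl. Qed.

Lemma rdot0l x : rdot 0 x = 0.
Proof. by have := rdotBl 0 0 x; rewrite !subrr. Qed.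

Lemma rdot0r x : rdot x 0 = 0.
Proof. by rewrite rdotC rdot0l. Qed.

Lemma rdot_suml (I : Type) (s : seq I) (P : pred I) (x : I -> H) y :
  rdot (\sum_(i <- s | P i) x i) y = \sum_(i <- s | P i) rdot (x i) y.
Proof. by apply: (big_morph (rdot^~ y)) => [u v|]; rewrite ?rdotDl ?rdot0l. Qed.

Lemma rdot_nrm x : rdot x x = nrm x ^+ 2.
Proof. by rewrite /rdot -hdot_norm nrmE -rmorphXn. Qed.

Lemma nrm_ge0 x : 0 <= nrm x.
Proof. by rewrite -(ler0c (nrm x)) -nrmE. Qed.

Lemma nrm0_eq0 x : nrm x = 0 -> x = 0.
Proof. by move=> x0; apply: normr0_eq0; rewrite nrmE x0. Qed.

Lemma rdot_eq0 x : rdot x x = 0 -> x = 0.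
Proof. by rewrite rdot_nrm => /eqP; rewrite sqrf_eq0 => /eqP/nrm0_eq0. Qed.

Lemma nrm0 : nrm 0 = 0.
Proof. by rewrite /nrm normr0. Qed.

Lemma nrmN x : nrm (- x) = nrm x.
Proof. by rewrite /nrm normrN. Qed.

Lemma nrmD x y : nrm (x + y) <= nrm x + nrm y.
Proof. by rewrite -lecR rmorphD /= -!nrmE ler_normD. Qed.

Lemma nrmB x y : nrm (x - y) <= nrm x + nrm y.
Proof. by rewrite -(nrmN y) nrmD. Qed.

Lemma nrmZ r x : 0 <= r -> nrm (rscale r x) = r * nrm x.
Proof.
move=> r0; apply: complexI.
by rewrite -nrmE normrZ rmorphM nrmE /= ger0_norm // ler0c.
Qed.

Lemma nrmZc c x : nrm (c *: x) = complex.Re `|c| * nrm x.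
Proof.
by rewrite /nrm normrZ nrmE /=; case: `|c| => a b /=; rewrite mulr0 subr0.
Qed.

Lemma discriminant_le (q b e : R) : 0 <= q ->
  (forall t, 0 <= t ^+ 2 * q + 2 * t * b + e) -> b ^+ 2 <= e * q.
Proof.
rewrite le_eqVlt => /predU1P[<-|q0] tP.
  rewrite mulr0; have [->|b0] := eqVneq b 0; first by rewrite expr0n.
  (* For q = 0 the expression is affine in t, and at this point it would be -1. *)
  have := tP (- (e + 1) / (2 * b)); rewrite mulr0 add0r.
  have -> : 2 * (- (e + 1) / (2 * b)) * b = - (e + 1) by field.
  by lra.
have := tP (- b / q).
have -> : (- b / q) ^+ 2 * q + 2 * (- b / q) * b + e = (e * q - b ^+ 2) / q.
  by field; rewrite gt_eqF.
by rewrite pmulr_lge0 ?invr_gt0 // subr_ge0.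
Qed.

Lemma rdot_sqr_le x y : rdot x y ^+ 2 <= nrm y ^+ 2 * nrm x ^+ 2.
Proof.
apply: discriminant_le => [|t]; first exact: sqr_ge0.
have := sqr_ge0 (nrm (rscale t x + y)); rewrite -!rdot_nrm.
rewrite rdotDl !rdotDr !rdotZl !rdotZr (rdotC y x); nra.
Qed.

Lemma norm_rdot_le x y : `|rdot x y| <= nrm x * nrm y.
Proof.
rewrite -(@ler_pXn2r _ 2) ?nnegrE ?mulr_ge0 ?nrm_ge0 //.
by rewrite real_normK ?num_real // exprMn mulrC rdot_sqr_le.
Qed.

Lemma rdot_le x y : rdot x y <= nrm x * nrm y.
Proof. exact: le_trans (ler_norm _) (norm_rdot_le _ _). Qed.

Lemma eq0_of_le_inv (a C : R) : (forall n : nat, a <= C / n.+1%:R) -> a <= 0.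
Proof.
move=> aC; apply/ler_addgt0Pl => e e0; rewrite addr0.
have [C0|C0] := leP C 0.
  by apply: le_trans (aC 0%N) _; rewrite invr1 mulr1 (le_trans C0) // ltW.
pose n := Num.bound (C / e).
apply: le_trans (aC n) _; rewrite ler_pdivrMr // mulrC -ler_pdivrMr //.
have /ltW := archi_boundP (ltW (divr_gt0 C0 e0)).
by move=> /le_trans; apply; rewrite ler_nat leqnSn.
Qed.

(** The explicit rate survives in the limit; the Riesz vector and the square root are both obtained
    in this form. *)
Lemma hilbert_complete (u : nat -> H) (C : R) :
  (forall n m, (n <= m)%N -> nrm (u m - u n) <= C / n.+1%:R) ->
  exists z, forall n, nrm (z - u n) <= C / n.+1%:R.
Proof.
move=> uC.
have small (e : R) : 0 < e -> exists N : nat, C / N.+1%:R < e.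
  move=> e0; apply: contrapT => /forallNP eC.
  have : e <= 0.
    by apply: (@eq0_of_le_inv _ C) => n; rewrite leNgt; apply/negP; exact: eC.
  by rewrite leNgt e0.
have : cvg (u @ \oo).
  apply/cauchy_cvgP; apply: cauchy_exP => e e0.
  have := e0; rewrite ltcE => /andP[/eqP Ie Re0].
  have [N Ne] := small _ Re0.
  exists (u N), N => // n /= Nn; rewrite -ball_normE /= distrC nrmE ltcE /=.
  by rewrite Ie eqxx /=; apply: le_lt_trans Ne; exact: uC.
move=> /cvg_ex[z] uz; exists z => n.
apply/ler_addgt0Pl => e e0.
have eC0 : 0 < e%:C by rewrite ltcR.
have /cvgrPdist_lt/(_ _ eC0)[N _ Nz] := uz.
have := Nz (maxn N n) (leq_maxl _ _); rewrite /= nrmE ltcR => ze.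
rewrite -(subrK (u (maxn N n)) z) -addrA; apply: le_trans (nrmD _ _) _.
by apply: lerD; [exact: ltW|apply: uC; exact: leq_maxr].
Qed.

(** z minimises |x|^2 - 2 l x: a minimising sequence is Cauchy by the parallelogram law, and the
    first variation vanishes in the limit. *)
Lemma riesz_real (l : H -> R) (M : R) :
  (forall x y, l (x + y) = l x + l y) -> (forall r x, l (rscale r x) = r * l x) ->
  (forall x, `|l x| <= M * nrm x) -> exists z, forall x, l x = rdot z x.
Proof.
move=> lD lZ lM.
pose J x := nrm x ^+ 2 - 2 * l x.
have JM x : - M ^+ 2 <= J x.
  have := sqr_ge0 (nrm x - M); have := ler_norm (l x); have := lM x.
  by rewrite /J; nra.
pose I := inf (range J).
have JI x : I <= J x.
  by apply: ge_inf; [exists (- M ^+ 2) => _ [y _ <-]|exists x].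
(* Chosen so that 4 e n = 1 / (n + 1)^2, the bound that the parallelogram law gives for |u m - u
   n|^2 when n <= m. *)
pose e (n : nat) : R := (2 * n.+1%:R)^-1 ^+ 2.
have e0 n : 0 < e n by rewrite exprn_gt0 // invr_gt0 mulr_gt0.
have /choice[u uP] n : exists x, J x < I + e n.
  have hI : has_inf (range J).
    by split; [exists (J 0), 0|exists (- M ^+ 2) => _ [y _ <-]].
  by have [_ [x _ <-] xI] := inf_adherent (e0 n) hI; exists x.
have eW n m : (n <= m)%N -> e m <= e n.
  move=> nm; rewrite /e lerXn2r ?nnegrE ?invr_ge0 ?mulr_ge0 //.
  by rewrite lef_pV2 ?posrE ?mulr_gt0 // ler_pM2l // ler_nat.
have e4 n : 4 * e n = n.+1%:R^-1 ^+ 2.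
  have : n.+1%:R != 0 :> R by rewrite pnatr_eq0.
  by rewrite /e; move: (n.+1%:R : R) => t t0; field.
have [n m nm|z zP] := @hilbert_complete u 1.
  rewrite mul1r -(@ler_pXn2r _ 2) ?nnegrE ?nrm_ge0 ?invr_ge0 // -e4.
  have := JI (rscale 2^-1 (u m + u n)); have := uP m; have := uP n; have := eW _ _ nm.
  rewrite /J lZ lD -!rdot_nrm !(rdotDl, rdotDr, rdotNl, rdotNr, rdotZl, rdotZr).
  by rewrite (rdotC (u n) (u m)); lra.
exists z => x; apply/eqP; rewrite -subr_eq0 -normr_eq0 eq_le normr_ge0 andbT.
apply: (@eq0_of_le_inv _ (2 * nrm x)) => n.
have uz : `|rdot (z - u n) x| <= n.+1%:R^-1 * nrm x.
  by apply: le_trans (norm_rdot_le _ _) _; rewrite ler_wpM2r ?nrm_ge0 // -[leRHS]mul1r.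
(* Near-minimality of u n along the line u n + t x, turned into an estimate by the discriminant. *)
have ul : (rdot (u n) x - l x) ^+ 2 <= e n * nrm x ^+ 2.
  apply: discriminant_le => [|t]; first exact: sqr_ge0.
  have := JI (u n + rscale t x); have := uP n.
  rewrite /J lD lZ -!rdot_nrm rdotDl !rdotDr !rdotZl !rdotZr (rdotC x (u n)).
  by lra.
have ul' : `|rdot (u n) x - l x| <= n.+1%:R^-1 * nrm x.
  rewrite -(@ler_pXn2r _ 2) ?nnegrE ?mulr_ge0 ?nrm_ge0 ?invr_ge0 //.
  rewrite real_normK ?num_real // (le_trans ul) // exprMn -e4 ler_wpM2r ?sqr_ge0 //.
  by have := e0 n; lra.
rewrite (_ : l x - rdot z x = - (rdot (u n) x - l x) - rdot (z - u n) x); last first.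
  by rewrite rdotBl; ring.
apply: le_trans (ler_normB _ _) _; rewrite normrN.
by apply: le_trans (lerD ul' uz) _; rewrite [leRHS]mulrAC -mulrA mulr_natl mulr2n mulrC.
Qed.

Lemma rdot_inj x y : (forall z, rdot z x = rdot z y) -> x = y.
Proof.
move=> xy; apply/eqP; rewrite -subr_eq0; apply/eqP/rdot_eq0.
by rewrite rdotDr rdotNr xy subrr.
Qed.

(** Up to sign, the imaginary part of <f x, y> is the real part at i x. *)
Lemma hdot_of_rdot (f g : H -> H) : (forall x, f ('i *: x) = 'i *: f x) ->
  (forall x y, rdot (f x) y = rdot x (g y)) ->
  forall x y, hdot H (f x) y = hdot H x (g y).
Proof.
move=> fi fg x y; have := fg ('i *: x) y; have := fg x y.
rewrite /rdot fi !hdotZl; case: (hdot H (f x) y) => a b; case: (hdot H x (g y)) => a' b' /=.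
by move=> ->; rewrite !mul0r !mul1r !sub0r => /oppr_inj ->.
Qed.

(** Riesz representation of x |-> Re <f x, y> shows that the selection in [adjoint] succeeds. *)
Lemma adjointP (f : {linear H -> H}) : (forall x, nrm (f x) <= nrm x) ->
  forall x y, hdot H (f x) y = hdot H x (adjoint f y).
Proof.
move=> f1; rewrite /adjoint; case: xgetP => [g _ //|none].
have /choice[g gP] y : exists z, forall x, rdot (f x) y = rdot z x.
  apply: (@riesz_real _ (nrm y)) => [x x'|r x|x].
  - by rewrite linearD rdotDl.
  - by rewrite /rscale linearZ rdotZl.
  - apply: le_trans (norm_rdot_le _ _) _; rewrite mulrC ler_wpM2l ?nrm_ge0 //.
exfalso; apply: (none g) => /=; apply: hdot_of_rdot => [x|x y].
  by rewrite linearZ.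
by rewrite gP rdotC.
Qed.

End HilbertGeometry.

(** * A square root of 1 - A for a symmetric contraction A *)

Section PositiveSquareRoot.
Variables (R : realType) (H : hilbertSpace R).
Local Open Scope complex_scope.

Lemma bounded_linear_cont (f : H -> H) (M : R) : linear f ->
  (forall x, nrm (f x) <= M * nrm x) -> continuous f.
Proof.
move=> flin fM.
pose Lf := GRing.isLinear.Build _ _ _ _ f flin.
pose F : {linear H -> H} := HB.pack f Lf.
apply: (@bounded_linear_continuous _ _ _ F); apply/linear_boundedP.
near=> r => x; rewrite !nrmE.
apply: (@le_trans _ _ ((M * nrm x)%:C)); first by rewrite lecR.
rewrite rmorphM /= ler_wpM2r // ?ler0c ?nrm_ge0 //.
by near: r; apply: nbhs_pinfty_ge; rewrite complex_real.
Unshelve. all: by end_near.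
Qed.

Lemma nrm_hdot_self (x : H) : hdot H x x = (nrm x ^+ 2)%:C.
Proof. by rewrite -hdot_norm nrmE rmorphXn. Qed.

Variable A : H -> H.
Hypothesis Alin : linear A.
Hypothesis A1 : forall x, nrm (A x) <= nrm x.
Hypothesis Asym : forall x y, rdot (A x) y = rdot x (A y).

(* Successive approximations of the solution of 2 Y = A + Y^2, so that
   (1 - Y)^2 = 1 - A; [sq_bound n] bounds the norm of [sq_iter n]. *)
Fixpoint sq_iter (n : nat) : H -> H :=
  if n is n'.+1 then fun x => rscale 2^-1 (A x + sq_iter n' (sq_iter n' x))
  else fun=> 0.

Fixpoint sq_bound (n : nat) : R :=
  if n is n'.+1 then 2^-1 * (1 + sq_bound n' ^+ 2) else 0.

Lemma sq_iter_lin n : linear (sq_iter n).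
Proof.
elim: n => [|n IHn] c x y /=; first by rewrite scaler0 addr0.
rewrite Alin !IHn addrACA -scalerDr /rscale [LHS]scalerDr; congr (_ + _).
by rewrite !scalerA mulrC.
Qed.

Lemma sq_iterB n x y : sq_iter n (x - y) = sq_iter n x - sq_iter n y.
Proof. by rewrite addrC -scaleN1r sq_iter_lin scaleN1r addrC. Qed.

(** The scalar recursion is that of [sq_iter] with A = 1. Its fixed point 1 is a double root, whence
    a rate of order 1 / n only. *)
Lemma sq_bound_ge n : 1 - 2 / n.+2%:R <= sq_bound n <= 1.
Proof.
elim: n => [|n /andP[lo hi]] /=.
  by rewrite divff ?subrr ?lexx ?ler01 // pnatr_eq0.
have lo0 : 0 <= 1 - 2 / n.+2%:R :> R.
  by rewrite subr_ge0 ler_pdivrMr ?ltr0n // mul1r ler_nat.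
have n0 : 0 < n.+2%:R :> R by rewrite ltr0n.
have b0 := le_trans lo0 lo.
have b1 : sq_bound n ^+ 2 <= 1 by rewrite expr_le1.
apply/andP; split; last by lra.
clear b0 b1.
have -> : n.+3%:R = n.+2%:R + 1 :> R by rewrite -natr1.
move: (n.+2%:R : R) n0 lo lo0 => t t0 lo lo0.
have st : (1 - 2 / t) ^+ 2 <= sq_bound n ^+ 2.
  by rewrite lerXn2r // nnegrE // (le_trans lo0).
have t1 : 0 < t + 1 by lra.
suff : 1 - 2 / (t + 1) <= 2^-1 * (1 + (1 - 2 / t) ^+ 2) by lra.
have -> : 2^-1 * (1 + (1 - 2 / t) ^+ 2) = 1 - 2 / (t + 1) + 2 / (t ^+ 2 * (t + 1)).
  by field; rewrite !gt_eqF.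
by rewrite lerDl divr_ge0 // mulr_ge0 // ?sqr_ge0 // ltW.
Qed.

Lemma sq_bound_ge0 n : 0 <= sq_bound n.
Proof. by case: n => //= n; rewrite mulr_ge0 // ?invr_ge0 // addr_ge0 // sqr_ge0. Qed.

(** With Y_n for [sq_iter n], Y_(n+2) - Y_(n+1) is half of Y_(n+1) (Y_(n+1) - Y_n) + (Y_(n+1) - Y_n)
    Y_n. The scalar bounds obey the same identity, so domination of the increments propagates. *)
Lemma sq_iter_bound n : (forall x, nrm (sq_iter n x) <= sq_bound n * nrm x) /\
  forall x, nrm (sq_iter n.+1 x - sq_iter n x) <= (sq_bound n.+1 - sq_bound n) * nrm x.
Proof.
have bound k : (forall x, nrm (sq_iter k x) <= sq_bound k * nrm x) ->
    forall x, nrm (sq_iter k.+1 x) <= sq_bound k.+1 * nrm x.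
  move=> kP x; rewrite /= nrmZ ?invr_ge0 // -mulrA ler_wpM2l ?invr_ge0 //.
  apply: le_trans (nrmD _ _) _; rewrite mulrDl mul1r lerD ?A1 //.
  apply: le_trans (kP _) _; rewrite expr2 -mulrA ler_wpM2l ?sq_bound_ge0 //.
elim: n => [|n [IH1 IH2]].
  split=> x; first by rewrite /= nrm0 mul0r.
  rewrite /= addr0 subr0 expr0n addr0 mulr1 subr0 nrmZ ?invr_ge0 //.
  by rewrite ler_wpM2l ?invr_ge0 // A1.
have b1 := bound _ IH1; split=> // x.
have -> : sq_iter n.+2 x - sq_iter n.+1 x = rscale 2^-1
    (sq_iter n.+1 (sq_iter n.+1 x - sq_iter n x) +
     (sq_iter n.+1 (sq_iter n x) - sq_iter n (sq_iter n x))).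
  rewrite sq_iterB addrA subrK [in LHS]/= -/(sq_iter n.+1) /rscale -scalerBr.
  by congr (_ *: _); rewrite opprD addrACA subrr add0r.
rewrite nrmZ ?invr_ge0 //.
have := nrmD (sq_iter n.+1 (sq_iter n.+1 x - sq_iter n x))
  (sq_iter n.+1 (sq_iter n x) - sq_iter n (sq_iter n x)).
have := b1 (sq_iter n.+1 x - sq_iter n x); have := IH2 (sq_iter n x).
have := IH2 x; have := IH1 x.
have := sq_bound_ge0 n; have := sq_bound_ge0 n.+1.
have dge : 0 <= sq_bound n.+1 - sq_bound n.
  by rewrite /=; have := sqr_ge0 (1 - sq_bound n); lra.
have bE : 2 * sq_bound n.+1 = 1 + sq_bound n ^+ 2 by rewrite /= mulrA divff ?mul1r.
rewrite [sq_bound n.+2]/= -/(sq_bound n.+1).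
move: bE dge (nrm_ge0 x) (nrm_ge0 (sq_iter n x)).
move: (sq_bound n) (sq_bound n.+1) (nrm x) (nrm (sq_iter n x))
  (nrm (sq_iter n.+1 x - sq_iter n x)) => b b' N N1 N2 bE h1 h2 h3 h4 h5 h6 h7 h8 h9 h10.
have k1 : (b' - b) * N1 <= (b' - b) * (b * N) by rewrite ler_wpM2l.
have k2 : b' * N2 <= b' * ((b' - b) * N) by rewrite ler_wpM2l.
have -> : 2^-1 * (1 + b' ^+ 2) - b' = 2^-1 * (b' ^+ 2 - b ^+ 2) by lra.
have -> : 2^-1 * (b' ^+ 2 - b ^+ 2) * N =
    2^-1 * (b' * ((b' - b) * N) + (b' - b) * (b * N)) by field.
by rewrite ler_wpM2l ?invr_ge0 //; lra.
Qed.

(** Telescoping leaves (sq_bound m - sq_bound n) |x|, at most 2 |x| / (n + 2). *)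
Lemma sq_iter_cauchy x n m : (n <= m)%N ->
  nrm (sq_iter m x - sq_iter n x) <= (2 * nrm x) / n.+1%:R.
Proof.
move=> nm; apply: (@le_trans _ _ ((sq_bound m - sq_bound n) * nrm x)).
  rewrite -(subnK nm); elim: (m - n)%N => [|k IHk].
    by rewrite add0n !subrr nrm0 mul0r.
  rewrite addSn -(subrK (sq_iter (k + n) x) (sq_iter _ x)) -addrA.
  apply: le_trans (nrmD _ _) _.
  have [_ /(_ x) step] := sq_iter_bound (k + n).
  have -> : sq_bound (k + n).+1 - sq_bound n =
    (sq_bound (k + n).+1 - sq_bound (k + n)) + (sq_bound (k + n) - sq_bound n).
    by rewrite addrA subrK.
  by rewrite mulrDl lerD.
rewrite mulrAC ler_wpM2r ?nrm_ge0 //.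
have /andP[lo _] := sq_bound_ge n; have /andP[_ hi] := sq_bound_ge m.
have : 2 / n.+2%:R <= 2 / n.+1%:R :> R.
  by rewrite ler_wpM2l // lef_pV2 ?posrE ?ltr0n // ler_nat.
by move: (2 / n.+2%:R : R) (2 / n.+1%:R : R) lo => s t; lra.
Qed.

Lemma sq_iter_sym n x y : rdot (sq_iter n x) y = rdot x (sq_iter n y).
Proof.
elim: n x y => [|n IHn] x y /=; first by rewrite rdot0l rdot0r.
by rewrite rdotZl rdotZr rdotDl rdotDr Asym !IHn.
Qed.

(** Linearity, symmetry and 2 Y = A + Y^2 pass to the pointwise limit Y with errors of order 1 / n;
    then 1 - Y is positive because |Y x| <= |x|. *)
Lemma sqrt_exists : exists g : H -> H, [/\ linear g, continuous g,
  forall x, 0 <= hdot H (g x) x & g \o g = (fun x => x - A x)].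
Proof.
have /choice[Y YP] x : exists y, forall n, nrm (y - sq_iter n x) <= (2 * nrm x) / n.+1%:R.
  by apply: hilbert_complete => n m; exact: sq_iter_cauchy.
have eq0 (z : H) (C : R) : (forall n : nat, nrm z <= C / n.+1%:R) -> z = 0.
  move=> zC; apply: nrm0_eq0; apply/eqP; rewrite eq_le nrm_ge0 andbT.
  exact: eq0_of_le_inv zC.
have iter1 n x : nrm (sq_iter n x) <= nrm x.
  have [/(_ x) h _] := sq_iter_bound n; apply: le_trans h _.
  by rewrite ler_piMl ?nrm_ge0 //; case/andP: (sq_bound_ge n).
have Y1 x : nrm (Y x) <= nrm x.
  rewrite -subr_le0; apply: (@eq0_of_le_inv R _ (2 * nrm x)) => n.
  have := YP x n; have := iter1 n x; have := nrmD (Y x - sq_iter n x) (sq_iter n x).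
  by rewrite subrK; move: (2 * nrm x / n.+1%:R) => t; lra.
have Ylin : linear Y.
  move=> c x y; apply/eqP; rewrite -subr_eq0; apply/eqP.
  apply: (eq0 _ (2 * nrm (c *: x + y) + (complex.Re `|c| * (2 * nrm x)
    + 2 * nrm y))) => n.
  have -> : Y (c *: x + y) - (c *: Y x + Y y) = (Y (c *: x + y) - sq_iter n (c *: x + y))
      - (c *: (Y x - sq_iter n x) + (Y y - sq_iter n y)).
    rewrite sq_iter_lin scalerBr addrACA -opprD.
    by rewrite [in RHS]opprB addrA subrK.
  apply: le_trans (nrmB _ _) _; rewrite mulrDl lerD //.
  apply: le_trans (nrmD _ _) _; rewrite mulrDl lerD // nrmZc -[leRHS]mulrA.
  by rewrite ler_wpM2l // -(ler0c (complex.Re _)) RRe_real ?ger0_real.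
have YB x y : Y (x - y) = Y x - Y y.
  by rewrite addrC -scaleN1r Ylin scaleN1r addrC.
have Ysym x y : rdot (Y x) y = rdot x (Y y).
  apply/eqP; rewrite -subr_eq0 -normr_eq0 eq_le normr_ge0 andbT.
  apply: (@eq0_of_le_inv R _ (2 * nrm x * nrm y + nrm x * (2 * nrm y))) => n.
  have -> : rdot (Y x) y - rdot x (Y y) =
      rdot (Y x - sq_iter n x) y - rdot x (Y y - sq_iter n y).
    by rewrite rdotBl rdotDr rdotNr sq_iter_sym; ring.
  apply: le_trans (ler_normB _ _) _; rewrite mulrDl; apply: lerD.
    apply: le_trans (norm_rdot_le _ _) _; rewrite mulrAC.
    by rewrite ler_wpM2r ?nrm_ge0.
  apply: le_trans (norm_rdot_le _ _) _; rewrite -mulrA.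
  by rewrite ler_wpM2l ?nrm_ge0.
have Yeq x : Y x + Y x = A x + Y (Y x).
  apply/eqP; rewrite -subr_eq0; apply/eqP.
  (* Four error terms, each at most 2 |x| / (n + 1). *)
  apply: (eq0 _ (8 * nrm x)) => n.
  have itS : sq_iter n.+1 x + sq_iter n.+1 x = A x + sq_iter n (sq_iter n x).
    rewrite /= -scalerDl -rmorphD (_ : 2^-1 + 2^-1 = 1) ?scale1r //.
    by lra.
  have -> : Y x + Y x - (A x + Y (Y x)) =
      ((Y x - sq_iter n.+1 x) + (Y x - sq_iter n.+1 x)) -
      ((Y (Y x) - sq_iter n (Y x)) + sq_iter n (Y x - sq_iter n x)).
    have -> : Y (Y x) - sq_iter n (Y x) + sq_iter n (Y x - sq_iter n x) =
        Y (Y x) - sq_iter n (sq_iter n x) by rewrite sq_iterB addrA subrK.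
    by rewrite addrACA -opprD itS opprB !opprD !addrA subrK.
  have := nrmB ((Y x - sq_iter n.+1 x) + (Y x - sq_iter n.+1 x))
    ((Y (Y x) - sq_iter n (Y x)) + sq_iter n (Y x - sq_iter n x)).
  have := nrmD (Y x - sq_iter n.+1 x) (Y x - sq_iter n.+1 x).
  have := nrmD (Y (Y x) - sq_iter n (Y x)) (sq_iter n (Y x - sq_iter n x)).
  have := iter1 n (Y x - sq_iter n x); have := YP x n; have := YP (Y x) n.
  have : nrm (Y x - sq_iter n.+1 x) <= 2 * nrm x / n.+1%:R.
    apply: le_trans (YP x n.+1) _; rewrite ler_wpM2l ?mulr_ge0 ?nrm_ge0 //.
    by rewrite lef_pV2 ?posrE ?ltr0n // ler_nat.
  have : 2 * nrm (Y x) / n.+1%:R <= 2 * nrm x / n.+1%:R.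
    by rewrite ler_wpM2r ?invr_ge0 // ler_wpM2l.
  have -> : 8 * nrm x / n.+1%:R = 4 * (2 * nrm x / n.+1%:R) by ring.
  by move: (2 * nrm x / n.+1%:R) (2 * nrm (Y x) / n.+1%:R) => s t; lra.
have glin : linear (fun x => x - Y x).
  by move=> c x y; rewrite Ylin scalerBr opprD addrACA.
exists (fun x => x - Y x); split=> //.
- apply: (@bounded_linear_cont _ 2) => // x; apply: le_trans (nrmB _ _) _.
  by have := Y1 x; lra.
(* The order on R[i] also demands a zero imaginary part, which the symmetry of Y supplies. *)
- move=> x; rewrite lecE /=; apply/andP; split; last first.
    rewrite -[complex.Re _]/(rdot (x - Y x) x) rdotBl subr_ge0.
    apply: le_trans (rdot_le _ _) _.
    by rewrite rdot_nrm expr2 ler_wpM2r ?nrm_ge0.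
  have Yi z : Y ('i *: z) = 'i *: Y z.
    have Y0 : Y 0 = 0 by have := YB z z; rewrite !subrr.
    by have := Ylin 'i z 0; rewrite Y0 !addr0.
  have := hdot_of_rdot Yi Ysym x x; rewrite [RHS]hdotC => Yr.
  rewrite hdotDl -scaleN1r hdotZl nrm_hdot_self; move: Yr.
  by case: (hdot H (Y x) x) => a b [] /= bN; apply/eqP; lra.
- apply/funext => x /=; rewrite YB.
  have -> : Y (Y x) = Y x + Y x - A x by rewrite Yeq addrAC subrr add0r.
  move: (Y x) (A x) => y z.
  by rewrite opprB -[y + y - z]addrA [y + _]addrC addrK addrA subrK.
Qed.

End PositiveSquareRoot.

Section LinearFunctions.
Variables (K : nzRingType) (V W : lmodType K) (f : V -> W).
Hypothesis flin : linear f.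

Lemma linear_fun0 : f 0 = 0.
Proof. by apply: (addrI (f 0)); have := flin 1 0 0; rewrite !scale1r !addr0. Qed.

Lemma linear_funD x y : f (x + y) = f x + f y.
Proof. by have := flin 1 x y; rewrite !scale1r. Qed.

Lemma linear_funZ c x : f (c *: x) = c *: f x.
Proof. by have := flin c x 0; rewrite linear_fun0 !addr0. Qed.

End LinearFunctions.

Section SpanClosure.
Variables (K : fieldType) (V : lmodType K) (I : finType) (b : I -> V).

Lemma span_mem i : span b (b i).
Proof.
exists (fun j => (j == i)%:R) => //; rewrite (bigD1 i) //= eqxx scale1r big1 ?addr0 //.
by move=> j /negPf ->; rewrite scale0r.
Qed.

Lemma span_add x y : span b x -> span b y -> span b (x + y).
Proof.
move=> [u _ <-] [v _ <-]; exists (fun i => u i + v i) => //.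
by rewrite -big_split; apply: eq_bigr => i _; rewrite scalerDl.
Qed.

Lemma span_scale c x : span b x -> span b (c *: x).
Proof.
move=> [u _ <-]; exists (fun i => c * u i) => //.
by rewrite scaler_sumr; apply: eq_bigr => i _; rewrite scalerA.
Qed.

Lemma span_sum (J : Type) (s : seq J) (P : pred J) (x : J -> V) :
  (forall j, P j -> span b (x j)) -> span b (\sum_(j <- s | P j) x j).
Proof.
move=> sx; apply: (big_ind (span b)) => //; last exact: span_add.
by exists (fun=> 0) => //; rewrite big1 // => i _; rewrite scale0r.
Qed.

Lemma indep_spans (S : set V) n (c : 'I_n -> V) : has_dim S n ->
  (forall i, S (c i)) -> indep c -> S `<=` span c.
Proof.
move=> Sn cS c_free x Sx.
have [e [_ SE]] := Sn.
have Sspan : S = span e by [].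
(* Otherwise x would extend c to an independent family of size n + 1. *)
apply: contrapT => xc.
pose c' (i : option 'I_n) := if i is Some j then c j else x.
have : (#|{: option 'I_n}| <= n)%N.
  have c'S i : S (c' i) by case: i.
  apply: (indep_le_dim Sn c'S) => a.
  have -> : \sum_i a i *: c' i = a None *: x + \sum_j a (Some j) *: c j.
    rewrite (bigD1 None) //=; congr (_ + _).
    rewrite (reindex_omap Some id) /=; last by case.
    by apply: eq_bigl => j; rewrite eqxx.
  have [a0|a0] := eqVneq (a None) 0.
    by rewrite a0 scale0r add0r => /c_free aS [j|].
  move=> /eqP; rewrite addr_eq0 => /eqP ax; exfalso; apply: xc.
  exists (fun j => - (a None)^-1 * a (Some j)) => //.
  rewrite -[RHS]scale1r -(mulVf a0) -scalerA ax scalerN scaler_sumr -sumrN.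
  by apply: eq_bigr => j _; rewrite mulNr scaleNr scalerA.
by rewrite card_option card_ord ltnn.
Qed.

End SpanClosure.

(** * The operators 1 - phi^n(1) *)

Section ModuleOperators.
Variables (R : realType) (d : nat) (H : hilbertModule R d).
Local Open Scope complex_scope.
Local Notation T := (@hop R d H).
Local Notation adj i := (adjoint (T i)).

Lemma hop_row_le (xi : 'I_d -> H) :
  nrm (\sum_i T i (xi i)) ^+ 2 <= \sum_i nrm (xi i) ^+ 2.
Proof.
have := hop_contractive xi; rewrite nrmE -rmorphXn.
have -> : \sum_i `|xi i| ^+ 2 = (\sum_i nrm (xi i) ^+ 2)%:C.
  by rewrite rmorph_sum; apply: eq_bigr => i _; rewrite nrmE -rmorphXn.
by rewrite lecR.
Qed.

Lemma hop_le i x : nrm (T i x) <= nrm x.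
Proof.
rewrite -(@ler_pXn2r _ 2) ?nnegrE ?nrm_ge0 //.
have := hop_row_le (fun j => if j == i then x else 0).
rewrite (bigD1 i) //= eqxx big1 ?addr0 => [|j /negPf ->]; last by rewrite linear0.
by rewrite (bigD1 i) //= eqxx big1 ?addr0 // => j /negPf ->; rewrite nrm0 expr0n.
Qed.

Lemma hdot_adj i x y : hdot H (T i x) y = hdot H x (adj i y).
Proof. exact: adjointP (hop_le i) x y. Qed.

Lemma rdot_adj i x y : rdot (T i x) y = rdot x (adj i y).
Proof. by rewrite /rdot hdot_adj. Qed.

Lemma adj_lin i : linear (adj i).
Proof.
move=> c x y; apply: rdot_inj => z.
by rewrite /rdot hdotDr hdotZr -!hdot_adj hdotDr hdotZr.
Qed.

Let A x := \sum_i T i (adj i x).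

Lemma phi_id_lin : linear A.
Proof.
move=> c x y; rewrite /A scaler_sumr -big_split; apply: eq_bigr => i _.
by rewrite adj_lin linearP.
Qed.

Lemma phi_id_sym x y : rdot (A x) y = rdot x (A y).
Proof.
rewrite /A rdot_suml [RHS]rdotC rdot_suml; apply: eq_bigr => i _.
by rewrite !rdot_adj rdotC.
Qed.

(** |A x|^2 <= sum_i |T_i^* x|^2 = <A x, x> <= |A x| |x|, the first step being contractivity of the
    row (T_1, ..., T_d). *)
Lemma phi_id_le x : nrm (A x) <= nrm x.
Proof.
have Axx : \sum_i nrm (adj i x) ^+ 2 = rdot (A x) x.
  by rewrite /A rdot_suml; apply: eq_bigr => i _; rewrite rdot_adj rdot_nrm.
have := hop_row_le (fun i => adj i x); rewrite Axx -/(A x) => AA.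
have := le_trans AA (rdot_le _ _).
have := nrm_ge0 (A x); rewrite le_eqVlt => /predU1P[<- _|A0]; first exact: nrm_ge0.
by rewrite expr2 ler_pM2l.
Qed.

Lemma defectP : [/\ linear (@defect R d H), continuous (@defect R d H),
  forall x, 0 <= hdot H (@defect R d H x) x &
  (@defect R d H) \o (@defect R d H) = (fun x => x - A x)].
Proof.
have [g gP] := sqrt_exists phi_id_lin phi_id_le phi_id_sym.
by rewrite /defect /sqrt_op; case: xgetP => [g' _ //|/(_ g)[]].
Qed.

Local Notation D := (@defect R d H).

Lemma defect_lin : linear D. Proof. by case: defectP. Qed.

Lemma defectK x : D (D x) = x - A x.
Proof. by have [_ _ _ /(congr1 (fun f => f x))] := defectP. Qed.

(** A positive form on a complex space is symmetric: <D z, z> is real, and z = x + i y compares the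
    mixed terms. *)
Lemma defect_sym x y : rdot (D x) y = rdot x (D y).
Proof.
have D_real z : complex.Im (hdot H (D z) z) = 0.
  by have [_ _ /(_ z) + _] := defectP; exact: ger0_Im.
have := D_real (x + 'i *: y); have := D_real x; have := D_real y.
rewrite (linear_funD defect_lin) (linear_funZ defect_lin) !(hdotDl, hdotDr, hdotZl, hdotZr) (rdotC x) /rdot.
case: (hdot H (D x) x) => a a'; case: (hdot H (D y) y) => b b'.
case: (hdot H (D x) y) => c c'; case: (hdot H (D y) x) => e e' /=.
by lra.
Qed.

Definition rank_op (n : nat) (x : H) : H := x - iter n (@phi R d H) id x.

Lemma rank_op0 x : rank_op 0 x = 0.
Proof. by rewrite /rank_op /= subrr. Qed.

Lemma rank_opS n x : rank_op n.+1 x = D (D x) + \sum_i T i (rank_op n (adj i x)).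
Proof.
rewrite /rank_op /= {1}/phi defectK /A.
under [X in _ = _ + X]eq_bigr do rewrite linearB.
by rewrite sumrB addrA subrK.
Qed.

Lemma rank_op_lin n : linear (rank_op n).
Proof.
elim: n => [|n IHn] c x y; first by rewrite !rank_op0 scaler0 addr0.
rewrite !rank_opS !defect_lin scalerDr addrACA; congr (_ + _).
rewrite scaler_sumr -big_split; apply: eq_bigr => i _.
by rewrite adj_lin IHn linearP.
Qed.

Lemma rdot_rank_opS n x : rdot (rank_op n.+1 x) x =
  nrm (D x) ^+ 2 + \sum_i rdot (rank_op n (adj i x)) (adj i x).
Proof.
rewrite rank_opS rdotDl defect_sym rdot_nrm rdot_suml; congr (_ + _).
by apply: eq_bigr => i _; rewrite rdot_adj.
Qed.

Lemma rdot_rank_op_ge0 n x : 0 <= rdot (rank_op n x) x.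
Proof.
elim: n x => [|n IHn] x; first by rewrite rank_op0 rdot0l.
by rewrite rdot_rank_opS addr_ge0 ?sqr_ge0 // sumr_ge0.
Qed.

(** By [rdot_rank_opS] the form is a sum of terms |D w|^2, where w runs over the images of v under
    products of at most n adjoints. All of them vanish, and the adjoints move back across the inner
    product as T_i. *)
Lemma rank_op_orthogonal n v : rdot (rank_op n.+1 v) v = 0 ->
  forall m x, (mdeg m <= n)%N -> rdot v (@monomial_act R d H m (D x)) = 0.
Proof.
elim: n v => [|n IHn] v /eqP; rewrite rdot_rank_opS paddr_eq0 ?sqr_ge0 //;
  do ?[by apply: sumr_ge0 => i _; exact: rdot_rank_op_ge0];
  move=> /andP[]; rewrite sqrf_eq0 => /eqP/nrm0_eq0 Dv0.
  move=> _ m x; rewrite leqn0 mdeg_eq0 => /eqP ->.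
  by rewrite monomial_act0 -defect_sym Dv0 rdot0l.
rewrite psumr_eq0 => [/allP v0 m x mn|i _]; last exact: rdot_rank_op_ge0.
have [->|m0] := eqVneq m mnm0; first by rewrite monomial_act0 -defect_sym Dv0 rdot0l.
have [i mi] : exists i, (0 < m i)%N.
  apply: contrapT => /forallNP mi; move/negP: m0; apply; apply/eqP/mnmP => i.
  by rewrite mnm0E; apply/eqP; rewrite -leqn0 leqNgt; apply/negP; exact: mi.
have mE : m = mnm_add (mnm1 i) (mnm_sub m (mnm1 i)).
  by rewrite addmC submK // lep1mP -lt0n.
rewrite mE monomial_actM monomial_act1 rdotC rdot_adj rdotC; apply: IHn.
  by apply/eqP/v0; rewrite mem_index_enum.
by move: mn; rewrite {1}mE mdegD mdeg1 add1n ltnS.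
Qed.

End ModuleOperators.

(** W is pulled back to a coordinate space, where it has a basis. For the range of D, known only to
    lie in a finite dimensional closure, this yields generators of the form D xi. *)
Lemma subspace_span (K : fieldType) (V : lmodType K) (S W : set V) n :
  has_dim S n -> W `<=` S -> W 0 -> (forall x y, W x -> W y -> W (x + y)) ->
  (forall c x, W x -> W (c *: x)) ->
  exists r (g : 'I_r -> V), (forall i, W (g i)) /\ W = span g.
Proof.
move=> [b [_ SE]] WS W0 WD WZ; have sA := is_action_scale V.
have [|r [B [_ WB]]] := @submodule_rowspan K n
    [set v | W (comb (fun (c : K) (x : V) => c *: x) b v)].
  split=> /=; first by rewrite (comb0 sA).
    by move=> u v; rewrite (combD sA); exact: WD.
  by move=> f u; rewrite (combZ sA); exact: WZ.
exists r, (fun i => comb (fun (c : K) (x : V) => c *: x) b (row i B)).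
have memB v : W (comb (fun (c : K) (x : V) => c *: x) b (v *m B)).
  have : [set v | W (comb (fun (c : K) (x : V) => c *: x) b v)] (v *m B).
    by rewrite WB; exists v.
  by [].
split=> [i|]; first by rewrite rowE.
rewrite span_comb; apply/seteqP; split=> x.
  move=> Wx; have := WS _ Wx; rewrite SE -/(span b) span_comb => -[v _ vx].
  have : [set v | W (comb (fun (c : K) (x : V) => c *: x) b v)] v by rewrite /= vx.
  by rewrite WB => -[u _ uv]; exists u; rewrite // -(comb_mulmx sA) uv.
by move=> [u _ <-]; rewrite -(comb_mulmx sA).
Qed.

(** * The range of 1 - phi^(n+1)(1) in the finite rank case *)

Section FiniteRank.
Variables (R : realType) (d : nat) (H : hilbertModule R d).
Local Notation A := (mpoly d R[i]).
Local Notation D := (@defect R d H).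
Variables (r : nat) (xi : 'I_r -> H).
Let g j := D (xi j).
Hypothesis rangeD : range D = span g.

Lemma defect_submoduleE : @defect_submodule R d H = range (comb (@act R d H) g).
Proof.
have aA := is_action_act H.
apply/seteqP; split=> x; last first.
  move=> [v _ <-]; exists [seq (v 0 j, xi j) | j <- index_enum 'I_r].
  by rewrite big_map.
move=> [s ->]; elim: s => [|[f y] s [v _ vE]].
  by rewrite big_nil; exists 0; rewrite // (comb0 aA).
rewrite big_cons -vE /=.
have : range D (D y) by exists y.
rewrite rangeD => -[c _ <-].
exists ((\row_j (f * mpolyC d (c j))) + v) => //; rewrite (combD aA); congr (_ + _).
rewrite (action_sumr aA); apply: eq_bigr => j _.
by rewrite mxE (actionM aA) actC.
Qed.

Lemma filtered_part_mem n m j : (mdeg m <= n)%N -> filtered_part g n (monomial_act m (g j)).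
Proof. by move=> mn; exact: (span_mem _ (j, BMultinom (mn : (mdeg m < n.+1)%N))). Qed.

Lemma filtered_part_defect n x : filtered_part g n (D x).
Proof.
have : range D (D x) by exists x.
rewrite rangeD => -[c _ <-]; apply: span_sum => j _; apply: span_scale.
by rewrite -[g j](monomial_act0 (g j)); apply: filtered_part_mem; rewrite mdeg0.
Qed.

Lemma filtered_part_hop n i x : filtered_part g n x -> filtered_part g n.+1 (hop H i x).
Proof.
move=> [c _ <-]; rewrite linear_sum; apply: span_sum => -[j m] _ /=.
rewrite linearZ; apply: span_scale; rewrite /= -monomial_act1 -monomial_actM.
by apply: filtered_part_mem; rewrite mdegD mdeg1 add1n; exact: bmdeg.
Qed.

Lemma rank_op_filtered n x : filtered_part g n (rank_op n.+1 x).
Proof.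
elim: n x => [|n IHn] x; rewrite rank_opS; apply: span_add;
  do ?exact: filtered_part_defect; apply: span_sum => i _.
  by rewrite rank_op0 linear0 -(scale0r (D x)); apply/span_scale/filtered_part_defect.
exact: filtered_part_hop.
Qed.

Lemma filtered_part_dim n : exists k, has_dim (filtered_part g n) k.
Proof.
have [|u _ []|k [kP _]] := @span_dim _ H _ 'I_0
  (fun p : 'I_r * bmultinom d n.+1 => monomial_act p.2 (g p.1)) (fun _ _ => 0).
- by case.
- by [].
- by exists k.
Qed.

Lemma rank_op_inj n v : filtered_part g n v -> rank_op n.+1 v = 0 -> v = 0.
Proof.
move=> vn v0; apply: rdot_eq0.
have vorth := @rank_op_orthogonal _ _ _ n v.
rewrite v0 rdot0l in vorth.
case: vn => a _ aE; rewrite -{1}aE rdot_suml big1 // => -[j m] _.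
rewrite /= -monomial_actZ /g -(linear_funZ (@defect_lin R d H)) rdotC; apply: vorth => //.
by rewrite -ltnS; exact: bmdeg.
Qed.

Lemma range_rank_op n : range (@rank_op R d H n.+1) = filtered_part g n.
Proof.
apply/seteqP; split=> x; first by move=> [y _ <-]; exact: rank_op_filtered.
have [k kP] := filtered_part_dim n; have [b [b_free bE]] := kP.
have bn i : filtered_part g n (b i) by rewrite bE; exact: (span_mem b i).
have Psum (a : 'I_k -> R[i]) :
    rank_op n.+1 (\sum_i a i *: b i) = \sum_i a i *: rank_op n.+1 (b i).
  elim/big_rec2: _ => [|i y1 y2 _ <-]; last by rewrite rank_op_lin.
  exact: (linear_fun0 (@rank_op_lin _ _ H n.+1)).
have cS i : filtered_part g n (rank_op n.+1 (b i)) by exact: rank_op_filtered.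
(* The images of a basis of M_n are equally many independent vectors of M_n, hence span it. *)
have c_free : indep (fun i => rank_op n.+1 (b i)).
  move=> a; rewrite -Psum => a0; apply: b_free; apply: rank_op_inj a0.
  by apply: span_sum => i _; exact: (span_scale _ (bn i)).
move=> /(indep_spans kP cS c_free) [a _ <-].
by exists (\sum_i a i *: b i); rewrite // Psum.
Qed.

End FiniteRank.

Theorem theoremC (R : realType) (d : nat) (hd : (1 <= d)%N)
    (H : hilbertModule R d) (hrank : finite_rank H) :
  let u : R^nat := fun n =>
    (set_dim (range (fun x : H => x - iter n.+1 (@phi R d H) id x)))%:R
      / (n ^ d)%:R in
  cvgn u /\ (euler_char H)%:~R = (d`!)%:R * limn u.
Proof.
move=> u.
have aA := is_action_act H.
have [N NP] := hrank.
have [||x y [x' _ <-] [y' _ <-]|c x [x' _ <-]|r [g0 [g0D rangeD]]] :=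
    @subspace_span _ H _ (range (@defect R d H)) N NP.
- exact: subset_closure.
- by exists 0 => //; exact: (linear_fun0 (@defect_lin R d H)).
- by exists (x' + y') => //; exact: (linear_funD (@defect_lin R d H)).
- by exists (c *: x') => //; exact: (linear_funZ (@defect_lin R d H)).
have /choice[xi xiP] j : exists x, @defect R d H x = g0 j.
  by have [x _ xE] := g0D j; exists x.
have gE : (fun j => @defect R d H (xi j)) = g0 by apply/funext => j; rewrite xiP.
rewrite -gE in rangeD.
pose g j := @defect R d H (xi j).
have [J [rel [Jfree relP]]] := max_free_subfamily (@act R d H) g.
pose e (i : 'I_#|J|) := g (enum_val i).
have chi : euler_char H = #|J|%:Z.
  apply: (@euler_char_eq _ _ _ _ r g e (defect_submoduleE rangeD)).
  - move=> i; exists (delta_mx 0 (enum_val i)) => //.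
    by rewrite (comb_delta aA).
  - exact: comb_sub_free.
  - by move=> x; exact: (comb_sub_max aA relP).
pose D n := set_dim (filtered_part g n).
have DP n : has_dim (filtered_part g n) (D n).
  by have [k kP] := filtered_part_dim xi n; rewrite /D (set_dim_eq kP).
(* The exponent n + 1 matches the degree bound n of [filtered_part], so no shift is left in the
   limit. *)
have uE : u = fun n => (D n)%:R / (n ^ d)%:R.
  by apply/funext => n; rewrite /u /D -(range_rank_op rangeD).
have [c cP] := filtered_part_dim_le relP.
have uJ : u @ \oo --> (#|J|%:R / d`!%:R : R).
  rewrite uE; apply: (@cvg_sandwich R d #|J| r c D).
  - by rewrite -[X in (_ <= X)%N]card_ord max_card.
  - by move=> n; rewrite -card_bmultinom; exact: (filtered_part_dim_ge Jfree (DP n)).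
  - move=> n cn; rewrite -!card_bmultinom; have [k [kP kle]] := cP n cn.
    by rewrite (has_dim_unique (DP n) kP).
split; first by apply/cvg_ex; exists (#|J|%:R / d`!%:R).
by rewrite (cvg_lim _ uJ) // chi mulrC divfK.
Qed.
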